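(* Let $n\ge 2$ and $\lfloor\frac{n+1}{2}\rfloor\le l\le\binom n2$. The map sending (the isomorphism class of) a fundamental basic block $F$ with exactly $n$ reducible elements $u_1<u_2<\cdots<u_n$ and nullity $l$ to the directed graph $\overrightarrow{G_F}$ on vertices $v_1,\dots,v_n$ having an arc $(v_i,v_j)$ (with $i<j$) exactly when $(u_i,u_j)$ is an adjunct pair in the adjunct representation of $F$ is a bijection from $\mathscr F_n(l)$ onto $\overrightarrow{\mathscr D}(n,l)$.
   Context: An element of a lattice is reducible if it is $y\vee z$ or $y\wedge z$ for some $y,z$ both distinct from it; an element of a poset is doubly irreducible if it has at most one upper and at most one lower cover. The nullity $\eta(P)$ of a finite poset is $|E|-|V|+c$ for its cover graph (edges = coverings), $c$ the number of components. Adjunct operation: for disjoint lattices $L_1,L_2$ and $a<b$ in $L_1$ with $b$ not covering $a$, $L_1\,]_a^b\,L_2$ is $L_1\cup L_2$ with $x\le y$ iff $x\le y$ within $L_1$ or within $L_2$, or $x\in L_1,y\in L_2,x\le a$, or $x\in L_2,y\in L_1,b\le y$. An RC-lattice is a finite lattice whose reducible elements are pairwise comparable; it is an adjunct of chains $C_0\,]_{a_1}^{b_1}C_1\cdots]_{a_r}^{b_r}C_r$ ($C_0$ maximal chain), unique up to order of adjunct pairs. A basic block is a poset that has one element, or has no doubly irreducible elements, or from which removal of a doubly irreducible element reduces nullity by one. A fundamental basic block is an RC-lattice that is a basic block whose adjunct representation has pairwise distinct adjunct pairs. $\mathscr F_n(l)$ is the set of isomorphism classes of fundamental basic blocks with exactly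 $n$ reducible elements and nullity $l$. $\overrightarrow{\mathscr D}(n,l)$ is the set of directed graphs on the labeled vertex set $\{v_1,\dots,v_n\}$ with exactly $l$ arcs, every arc of the form $(v_i,v_j)$ with $i<j$, and no isolated vertex (labeled graphs are identified only if they have the same arc set). *)

(* Defs.v *)
From mathcomp Require Import all_boot.
Set Implicit Arguments. Unset Strict Implicit. Unset Printing Implicit Defensive.

Section PosetDefs.
Variables (T : finType) (le : rel T).

Definition is_poset : Prop :=
  reflexive le /\ antisymmetric le /\ transitive le.

Definition is_lub_in (S : {pred T}) (x y j : T) : bool :=
  [&& j \in S, le x j, le y j &
      [forall z, (z \in S) ==> le x z ==> le y z ==> le j z]].
Definition is_glb_in (S : {pred T}) (x y m : T) : bool :=
  [&& m \in S, le m x, le m y &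
      [forall z, (z \in S) ==> le z x ==> le z y ==> le z m]].

Definition is_lub x y j := is_lub_in predT x y j.
Definition is_glb x y m := is_glb_in predT x y m.

Definition is_lattice_on (S : {pred T}) : Prop :=
  forall x y, x \in S -> y \in S ->
    (exists j, is_lub_in S x y j) /\ (exists m, is_glb_in S x y m).

Definition is_finite_lattice : Prop :=
  is_poset /\ 0 < #|T| /\ is_lattice_on predT.

Definition reducible (x : T) : bool :=
  [exists y, exists z, [&& y != x, z != x & is_lub y z x || is_glb y z x]].

Definition is_RC_lattice : Prop :=
  is_finite_lattice /\
  forall x y, reducible x -> reducible y -> le x y || le y x.

Definition covers_in (A : {set T}) (x y : T) : bool :=
  [&& x \in A, y \in A, le x y, x != y &
      [forall z, (z \in A) ==>
         ~~ [&& le x z, le z y, z != x & z != y]]].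

Definition covers := covers_in setT.

Definition doubly_irr (x : T) : bool :=
  (#|[set y | covers x y]| <= 1) && (#|[set y | covers y x]| <= 1).

Definition cover_graph (A : {set T}) : rel T :=
  fun x y => covers_in A x y || covers_in A y x.

(* nullity |E| - |V| + c of the cover graph of the subposet A
   (the quantity |E| + c - |V| is always >= 0, so nat subtraction is exact) *)
Definition nullity (A : {set T}) : nat :=
  #|[set p : T * T | covers_in A p.1 p.2]|
  + n_comp (cover_graph A) [pred x | x \in A] - #|A|.

Definition basic_block : Prop :=
  #|T| = 1 \/ (forall x, ~~ doubly_irr x) \/
  (forall x, doubly_irr x -> nullity setT = (nullity (setT :\ x)).+1).

(* Adjunct representation C_0 ]_{a_1}^{b_1} C_1 ... ]_{a_r}^{b_r} C_r of
   the lattice (T,le), realised inside T: c x is the index of the chain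
   containing x, L_i = {x | c x <= i}, (a i, b i) is the i-th adjunct pair
   (1 <= i <= r). *)
Definition adj_rep (r : nat) (c : T -> nat) (a b : nat -> T) : Prop :=
  (forall x, c x <= r) /\
  (exists x, c x = 0) /\
  (forall x y, c x = 0 -> c y = 0 -> le x y || le y x) /\
  (forall y, (forall x, c x = 0 -> le x y || le y x) -> c y = 0) /\
  (* L_i = L_{i-1} ]_{a_i}^{b_i} C_i *)
  (forall i, 1 <= i <= r ->
     (exists x, c x = i) /\
     (forall x y, c x = i -> c y = i -> le x y || le y x) /\
     is_lattice_on [pred x | c x < i] /\
     c (a i) < i /\ c (b i) < i /\ le (a i) (b i) /\ a i <> b i /\
     (exists z, c z < i /\ z <> a i /\ z <> b i /\ le (a i) z /\ le z (b i)) /\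
     (forall x y, c x < i -> c y = i -> le x y = le x (a i)) /\
     (forall x y, c x = i -> c y < i -> le x y = le (b i) y)).

Definition adjunct_pair (x y : T) : Prop :=
  exists r c a b, adj_rep r c a b /\
    exists i, 1 <= i <= r /\ a i = x /\ b i = y.

Definition fundamental_basic_block : Prop :=
  is_RC_lattice /\ basic_block /\
  exists r c a b, adj_rep r c a b /\
    (forall i j, 1 <= i <= r -> 1 <= j <= r -> a i = a j -> b i = b j -> i = j).

Definition num_reducible : nat := #|[set x | reducible x]|.

(* position of x in the chain of reducible elements u_1 < ... < u_n
   (0-based: u_{k+1} has rank k) *)
Definition red_rank (x : T) : nat :=
  #|[set y | [&& reducible y, le y x & y != x]]|.

Definition GF_arc (n : nat) (i j : 'I_n) : Prop :=
  exists x y, [&& reducible x, reducible y, red_rank x == i & red_rank y == j]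
              /\ adjunct_pair x y.

End PosetDefs.

Definition poset_iso (T1 T2 : finType) (le1 : rel T1) (le2 : rel T2) : Prop :=
  exists f : T1 -> T2, bijective f /\ forall x y, le1 x y = le2 (f x) (f y).

Definition Dgraph (n l : nat) (D : {set 'I_n * 'I_n}) : bool :=
  [&& [forall p in D, p.1 < p.2], #|D| == l &
      [forall v : 'I_n, [exists p in D, (p.1 == v) || (p.2 == v)]]].

Definition in_Fnl (n l : nat) (T : finType) (le : rel T) : Prop :=
  fundamental_basic_block le /\ num_reducible le = n /\ nullity le setT = l.

(* Main.v *)
Require Import Defs.
From mathcomp Require Import all_boot.
From mathcomp Require Import zify.

Set Implicit Arguments. Unset Strict Implicit. Unset Printing Implicit Defensive.

(* In a fundamental basic block every irreducible element z has a unique lower cover [lo z]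
   and a unique upper cover [hi z]; both are reducible, and some other element lies between
   them. Hence distinct x, y satisfy x <= y iff hi x <= lo y: the order is determined by the ranks of the feet
   (lo x, hi x) in the chain of reducible elements (with lo x = hi x = x for reducible x).
   In any adjunct representation the adjunct pairs are exactly the pairs (lo z, hi z), and
   if the pairs are distinct then each pair is the feet of exactly one irreducible element,
   or of exactly two when no reducible element lies between. So the digraph determines the
   sizes of the fibers of x |-> (lo x, hi x), and therefore the block up to isomorphism.
   Conversely every digraph without isolated vertices yields such a block, whose nullity is
   the number of arcs: outside a spanning tree of its cover graph there is one edge per arc. *)

(** * Covers in a finite poset *)

Section Poset.
Variables (T : finType) (le : rel T).
Hypothesis le_poset : is_poset le.

Lemma po_refl x : le x x.
Proof. by case: le_poset => r _; apply: r. Qed.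

Lemma po_anti x y : le x y -> le y x -> x = y.
Proof. by case: le_poset => _ [a _] h1 h2; apply: a; rewrite h1. Qed.

Lemma po_trans y x z : le x y -> le y z -> le x z.
Proof. by case: le_poset => _ [_ t]; apply: t. Qed.

Lemma covers_inP (A : {set T}) x y :
  reflect [/\ x \in A, y \in A, le x y, x != y &
              forall z, z \in A -> le x z -> le z y -> z = x \/ z = y]
          (covers_in le A x y).
Proof.
apply: (iffP and5P) => -[xA yA xy nxy h]; split=> //.
- move=> z zA xz zy; move/forallP/(_ z): h; rewrite zA xz zy /=.
  by rewrite negb_and !negbK => /orP[]/eqP; [left|right].
apply/forallP => z; apply/implyP => zA; apply/negP => /and4P[xz zy nzx nzy].
by case: (h z zA xz zy) => e; rewrite e eqxx in nzx nzy.
Qed.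

(** Among the elements of [A] above [x] and strictly below [y], one with the largest down-set is
    maximal, since a strictly larger [w] adds itself to the down-set. *)
Lemma lower_cover_in (A : {set T}) x y :
  x \in A -> y \in A -> le x y -> x != y ->
  exists2 z, covers_in le A z y & le x z.
Proof.
move=> xA yA xy nxy.
pose P z := [&& z \in A, le x z, le z y & z != y].
have Px : P x by rewrite /P xA po_refl xy nxy.
case: (@arg_maxnP _ x P (fun z => #|[set w | le w z]|) Px) => z.
case/and4P=> zA xz zy nzy zmax.
exists z => //; apply/covers_inP; split=> // w wA zw wy.
case: (eqVneq w y) => [|nwy]; [by right|left].
have /zmax : P w by rewrite /P wA (po_trans xz zw) wy nwy.
rewrite /= leqNgt => h.
apply/eqP/negPn/negP => nwz; case/negP: h; apply: proper_card.
apply/properP; split; first by apply/subsetP => v; rewrite !inE => /po_trans; apply.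
exists w; rewrite !inE ?po_refl //; apply: contra nwz => wz.
by apply/eqP/po_anti.
Qed.

End Poset.

Lemma covers_in_dual (T : finType) (le : rel T) (A : {set T}) x y :
  covers_in (fun a b => le b a) A x y = covers_in le A y x.
Proof.
rewrite /covers_in eq_sym andbCA; do 4!congr (_ && _).
apply: eq_forallb => z; congr (_ ==> ~~ _).
by rewrite andbCA; do 2!congr (_ && _); rewrite andbC.
Qed.

Lemma dual_poset (T : finType) (le : rel T) :
  is_poset le -> is_poset (fun a b => le b a).
Proof.
move=> P; split=> [x|]; first exact: (po_refl P).
split=> [x y /andP[yx xy]|y x z yx zy]; first exact: (po_anti P).
exact: (po_trans P zy yx).
Qed.

Lemma upper_cover_in (T : finType) (le : rel T) (A : {set T}) x y :
  is_poset le -> x \in A -> y \in A -> le x y -> x != y ->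
  exists2 z, covers_in le A x z & le z y.
Proof.
move=> /dual_poset P xA yA xy; rewrite eq_sym => nyx.
have [z cz zy] := lower_cover_in P yA xA xy nyx.
by exists z => //; rewrite covers_in_dual in cz.
Qed.

(** * Nullity and the deletion of one element *)

Section Nullity.
Variables (T : finType) (le : rel T).
Hypothesis le_poset : is_poset le.
Let po_refl := po_refl le_poset.
Let po_anti := po_anti le_poset.
Let po_trans := po_trans le_poset.

Lemma cover_graph_sym (A : {set T}) : symmetric (cover_graph le A).
Proof. by move=> x y; rewrite /cover_graph orbC. Qed.

Lemma cover_graph_closed (A : {set T}) :
  closed (cover_graph le A) [pred x | x \in A].
Proof.
by move=> x y; rewrite !inE => /orP[]/covers_inP[-> -> _ _ _].
Qed.

(** Descending through lower covers joins every element of [A] to [m], the down-set shrinking at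
    each step. *)
Lemma n_comp_bottom (A : {set T}) m :
  m \in A -> (forall x, x \in A -> le m x) ->
  n_comp (cover_graph le A) [pred x | x \in A] = 1.
Proof.
move=> mA mle; have sym := sym_connect_sym (@cover_graph_sym A).
rewrite -(n_comp_connect sym m); apply: eq_n_comp_r => x; apply/idP/idP; last first.
  by move=> mx; rewrite -(closed_connect (@cover_graph_closed A) mx).
rewrite !inE => xA.
have [k] := ubnP #|[set w | le w x]|; elim: k x xA => // k IH x xA lek.
case: (eqVneq m x) => [->|nmx]; first exact: connect0.
have [y cyx _] := lower_cover_in le_poset mA xA (mle _ xA) nmx.
have /covers_inP[yA _ yx nyx _] := cyx.
apply: (@connect_trans _ _ y); last by apply: connect1; rewrite /cover_graph cyx.
apply: IH => //; rewrite ltnS in lek; apply: leq_trans lek.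
apply: proper_card; apply/properP; split.
  by apply/subsetP => w; rewrite !inE => /po_trans; apply.
exists x; rewrite !inE ?po_refl //.
by apply: contra nyx => xy; apply/eqP/po_anti.
Qed.

Lemma n_comp_gt0 (A : {set T}) x :
  x \in A -> 0 < n_comp (cover_graph le A) [pred x | x \in A].
Proof.
move=> xA; have sym := sym_connect_sym (@cover_graph_sym A).
apply/card_gt0P; exists (root (cover_graph le A) x).
rewrite !inE roots_root //=.
have h := closed_connect (@cover_graph_closed A) (connect_root (cover_graph le A) x).
by rewrite !inE in h; rewrite -h.
Qed.

Lemma card_covers_split x :
  #|[set p | covers le p.1 p.2]| =
  #|[set p | covers le p.1 p.2 && (p.1 != x) && (p.2 != x)]|
  + #|[set y | covers le x y]| + #|[set y | covers le y x]|.
Proof.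
rewrite -(cardsID [set p : T * T | p.1 == x]).
rewrite -(cardsID [set p : T * T | p.2 == x] (_ :\: _)).
have -> : #|[set y | covers le x y]| =
   #|[set p | covers le p.1 p.2] :&: [set p : T * T | p.1 == x]|.
  rewrite -(card_imset _ (_ : injective (pair x))); last by move=> ? ? [].
  apply: eq_card => -[a b]; rewrite !inE; apply/imsetP/andP => /=.
    by case=> y; rewrite inE => cy [-> ->].
  by case=> h /eqP e; exists b; rewrite ?inE -?e.
have -> : #|[set y | covers le y x]| =
   #|([set p | covers le p.1 p.2] :\: [set p : T * T | p.1 == x])
       :&: [set p : T * T | p.2 == x]|.
  rewrite -(card_imset _ (_ : injective (fun y => (y, x)))); last by move=> ? ? [].
  apply: eq_card => -[a b]; rewrite !inE /= -andbA; apply/imsetP/and3P.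
    by case=> y; rewrite inE => cy [-> ->]; split=> //; case/covers_inP: cy.
  by case=> h1 h /eqP e; exists a; rewrite ?inE -?e.
have -> : #|[set p | covers le p.1 p.2] :\: [set p : T * T | p.1 == x]
       :\: [set p : T * T | p.2 == x]| = 
   #|[set p | covers le p.1 p.2 && (p.1 != x) && (p.2 != x)]|.
  by apply: eq_card => -[a b]; rewrite !inE /= andbC; congr (_ && _); rewrite andbC.
lia.
Qed.

Lemma covers_delete x a b :
  covers le a b -> a != x -> b != x -> covers_in le (setT :\ x) a b.
Proof.
case/covers_inP=> _ _ ab nab h ax bx; apply/covers_inP.
by split; rewrite ?inE ?ax ?bx // => z _; apply: h; rewrite inE.
Qed.

Lemma nullity_bottom m : (forall x, le m x) ->
  nullity le setT = #|[set p | covers le p.1 p.2]|.+1 - #|T|.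
Proof.
move=> mle; rewrite /nullity (@n_comp_bottom _ m) ?inE //.
by rewrite cardsT addn1.
Qed.

(** Deleting [x] loses one vertex and at most two edges, and all other coverings survive. A drop by
    one leaves no room for a new covering, whereas without a detour [y] the deletion would make [q]
    cover [p]. *)
Lemma nullity_drop_detour m x :
  (forall y, le m y) -> 1 < #|T| -> doubly_irr le x ->
  nullity le setT = (nullity le (setT :\ x)).+1 ->
  exists p q y, [/\ covers le p x, covers le x q, le p y, le y q &
                    [/\ y != p, y != q & y != x]].
Proof.
move=> mle T1 /andP[up low] drop.
have [y yx] : exists y, y \in setT :\ x.
  by apply/card_gt0P; rewrite -cardsT (cardsD1 x) inE in T1.
have n0 := n_comp_gt0 yx.
have cT : #|T| = #|setT :\ x|.+1 by rewrite -cardsT (cardsD1 x) inE add1n.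
have sub : [set p | covers le p.1 p.2 && (p.1 != x) && (p.2 != x)]
    \subset [set p | covers_in le (setT :\ x) p.1 p.2].
  by apply/subsetP => -[a b]; rewrite !inE /= => /andP[/andP[h1 h2] h3]; apply: covers_delete.
have Esub := subset_leq_card sub.
rewrite (nullity_bottom mle) cT (card_covers_split x) /nullity in drop.
(* [e0] counts the coverings avoiding [x], [u] and [d] its upper and lower covers; [v], [e] and [k]
   count vertices, coverings and components after deletion. *)
have arith e0 u d v k e : 0 < k -> e0 <= e -> u <= 1 -> d <= 1 ->
    (e0 + u + d).+1 - v.+1 = (e + k - v).+1 -> [/\ 0 < u, 0 < d & e <= e0].
  by move=> *; split; lia.
have [up1 low1 Ele] := arith _ _ _ _ _ _ n0 Esub up low drop.
case/card_gt0P: up1 => q; rewrite inE => xq.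
case/card_gt0P: low1 => p; rewrite inE => px.
case: (boolP [exists y, [&& le p y, le y q, y != p, y != q & y != x]]).
  by case/existsP=> z /and5P[h1 h2 h3 h4 h5]; exists p, q, z.
move=> /existsPn nex.
have /covers_inP[_ _ lpx npx _] := px.
have /covers_inP[_ _ lxq nxq _] := xq.
have pq : covers_in le (setT :\ x) p q.
  apply/covers_inP; rewrite !inE npx eq_sym nxq (po_trans lpx lxq); split=> //.
    by apply: contraNneq npx => e; rewrite -e in lxq; apply/eqP/po_anti.
  move=> z; rewrite !inE andbT => zx pz zq; move: (nex z); rewrite pz zq zx /= andbT.
  by rewrite negb_and !negbK => /orP[]/eqP; [left|right].
have : #|(p, q) |: [set p | covers le p.1 p.2 && (p.1 != x) && (p.2 != x)]|
   <= #|[set p | covers_in le (setT :\ x) p.1 p.2]|.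
  apply/subset_leq_card/subsetP => z; rewrite in_setU1 => /orP[/eqP->|]; first by rewrite inE.
  by move/(subsetP sub).
rewrite cardsU1 inE /=.
have -> : covers le p q = false.
  apply/negP => /covers_inP[_ _ _ _ /(_ x)]; rewrite inE => /(_ isT lpx lxq).
  by case=> e; rewrite e eqxx in npx nxq.
by move/leq_trans/(_ Ele); rewrite ltnn.
Qed.

(** Exactly one vertex and two edges are lost. A new covering would have had [x] in between, hence
    also the detour [y]. The bound on [#|T|] keeps the truncated subtraction exact. *)
Lemma nullity_delete m x p q y :
  (forall z, le m z) -> doubly_irr le x -> covers le p x -> covers le x q ->
  le p y -> le y q -> y != p -> y != q -> y != x ->
  #|T| <= #|[set p | covers le p.1 p.2]| ->
  nullity le setT = (nullity le (setT :\ x)).+1.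
Proof.
move=> mle /andP[up low] px xq py yq nyp nyq nyx ET.
have /covers_inP[_ _ lpx npx _] := px.
have /covers_inP[_ _ lxq nxq _] := xq.
have cT : #|T| = #|setT :\ x|.+1 by rewrite -cardsT (cardsD1 x) inE add1n.
have nmx : m != x.
  by apply: contraNneq npx => e; apply/eqP/po_anti => //; rewrite -e.
have lowP a : le a x -> a != x -> le a p.
  move=> ax nax.
  have [||z cz az] := @lower_cover_in _ _ le_poset setT a x _ _ ax nax; rewrite ?inE //.
  suff -> : p = z by [].
  by move/card_le1_eqP: low; apply; rewrite inE.
have upP a : le x a -> a != x -> le q a.
  rewrite eq_sym => xa nxa.
  have [||z cz za] := @upper_cover_in _ _ setT x a le_poset _ _ xa nxa; rewrite ?inE //.
  suff -> : q = z by [].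
  by move/card_le1_eqP: up; apply; rewrite inE.
have eqE : [set p | covers le p.1 p.2 && (p.1 != x) && (p.2 != x)]
    = [set p | covers_in le (setT :\ x) p.1 p.2].
  apply/setP => -[a b]; rewrite !inE /=; apply/idP/idP.
    by move=> /andP[/andP[h1 h2] h3]; apply: covers_delete.
  case/covers_inP; rewrite !inE !andbT => ax bx ab nab h; rewrite ax bx !andbT.
  apply/covers_inP; rewrite !inE; split=> // z _ az zb.
  case: (eqVneq z x) => [ez|nzx]; last by apply: h; rewrite ?inE ?nzx.
  rewrite ez in az zb.
  have ap := lowP _ az ax; have qb := upP _ zb bx.
  have := h y; rewrite !inE nyx => /(_ isT (po_trans ap py) (po_trans yq qb)).
  case=> e; [case/eqP: nyp|case/eqP: nyq]; apply: po_anti => //.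
    by rewrite e.
  by rewrite e.
rewrite (nullity_bottom mle) /nullity (@n_comp_bottom _ m) ?inE ?nmx //.
rewrite (card_covers_split x) eqE in ET *; rewrite cT in ET *.
have up1 : 0 < #|[set y | covers le x y]| by apply/card_gt0P; exists q; rewrite inE.
have low1 : 0 < #|[set y | covers le y x]| by apply/card_gt0P; exists p; rewrite inE.
have arith e u d v : 0 < u -> 0 < d -> u <= 1 -> d <= 1 -> v.+1 <= e + u + d ->
    (e + u + d).+1 - v.+1 = (e + 1 - v).+1 by lia.
exact: arith up1 low1 up low ET.
Qed.

End Nullity.


(** * Reducibility in finite lattices *)

Section Lattice.
Variables (T : finType) (le : rel T).

Lemma is_lubP x y j :
  reflect [/\ le x j, le y j & forall z, le x z -> le y z -> le j z]
          (is_lub le x y j).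
Proof.
apply: (iffP and4P) => [[_ xj yj /forallP h]|[xj yj h]]; split=> //.
  by move=> z xz yz; move: (h z); rewrite xz yz.
by apply/forallP => z; apply/implyP => _; apply/implyP => xz; apply/implyP; apply: h.
Qed.

Lemma is_glbP x y j :
  reflect [/\ le j x, le j y & forall z, le z x -> le z y -> le z j]
          (is_glb le x y j).
Proof.
apply: (iffP and4P) => [[_ xj yj /forallP h]|[xj yj h]]; split=> //.
  by move=> z xz yz; move: (h z); rewrite xz yz.
by apply/forallP => z; apply/implyP => _; apply/implyP => xz; apply/implyP; apply: h.
Qed.

Lemma reducibleP x :
  reflect (exists y z, [/\ y != x, z != x & is_lub le y z x || is_glb le y z x])
          (reducible le x).
Proof.
apply: (iffP existsP) => [[y /existsP[z /and3P[h1 h2 h3]]]|[y [z [h1 h2 h3]]]].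
  by exists y, z.
by exists y; apply/existsP; exists z; apply/and3P.
Qed.

Lemma reducible_dual x : reducible (fun a b => le b a) x = reducible le x.
Proof.
by apply: eq_existsb => y; apply: eq_existsb => z; rewrite orbC.
Qed.

Lemma dual_lattice :
  is_finite_lattice le -> is_finite_lattice (fun a b => le b a).
Proof.
case=> P [T0 L]; split; first exact: dual_poset.
by split=> // x y xT yT; have [] := L x y xT yT.
Qed.

(** An element with the smallest down-set works: its meet with any [x] has a down-set contained in
    that one, hence equal to it. *)
Lemma bottom_exists : is_finite_lattice le -> exists m, forall x, le m x.
Proof.
case=> P [/card_gt0P[x0 _] L].
have [m _ mmin] := @arg_minnP _ x0 predT (fun m => #|[set w | le w m]|) isT.
exists m => x; have [_ [g /is_glbP[gm gx _]]] := L m x isT isT.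
have sub : [set w | le w g] \subset [set w | le w m].
  by apply/subsetP => w; rewrite !inE => wg; apply: (po_trans P wg gm).
have /eqP e : [set w | le w g] == [set w | le w m].
  by rewrite eqEcard sub; apply: mmin.
have : m \in [set w | le w m] by rewrite inE (po_refl P).
by rewrite -e inE => mg; apply: (po_trans P mg gx).
Qed.

(** With a single lower cover of [x], both [y] and [z] would lie below it, and so would their join
    [x]. *)
Lemma lub_lower_covers x y z :
  is_poset le -> is_lub le y z x -> y != x -> z != x ->
  1 < #|[set w | covers le w x]|.
Proof.
move=> P /is_lubP[yx zx lub] nyx nzx; rewrite ltnNge; apply/negP => /card_le1_eqP one.
have [||y' cy yy'] := @lower_cover_in _ _ P setT y x _ _ yx nyx; rewrite ?inE //.
have [||z' cz zz'] := @lower_cover_in _ _ P setT z x _ _ zx nzx; rewrite ?inE //.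
have e : y' = z' by apply: one; rewrite inE.
rewrite -e in zz'; have xy := lub _ yy' zz'.
by case/(covers_inP): cy => _ _ y'x /eqP[]; apply: (po_anti P).
Qed.

Lemma lower_covers_reducible x :
  is_finite_lattice le -> 1 < #|[set w | covers le w x]| -> reducible le x.
Proof.
case=> P [_ L] /card_gt1P[y [z [/[!inE] cy cz nyz]]].
have /covers_inP[_ _ yx nyx hy] := cy; have /covers_inP[_ _ zx nzx hz] := cz.
have [[j lubj] _] := L y z isT isT.
have /is_lubP[yj zj hj] := lubj; have jx := hj _ yx zx.
apply/reducibleP; exists y, z; split=> //; apply/orP; left.
case: (hy j) => //; last by move=> <-.
move=> ej; rewrite ej in zj; case: (hz y); rewrite ?inE // => e.
  by rewrite e eqxx in nyz.
by rewrite e eqxx in nyx.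
Qed.
End Lattice.

(** Joins are detected by two lower covers; meets are joins of the dual order. *)
Lemma reducibleE (T : finType) (le : rel T) x :
  is_finite_lattice le -> reducible le x = ~~ doubly_irr le x.
Proof.
move=> L; have P := proj1 L; have dL := dual_lattice L; have dP := proj1 dL.
have dual_card : #|[set w | covers (fun a b => le b a) w x]| = #|[set w | covers le x w]|.
  by apply: eq_card => w; rewrite !inE /covers covers_in_dual.
rewrite /doubly_irr negb_and -!ltnNge; apply/idP/orP => [/reducibleP[y [z [nyx nzx]]]|].
  case/orP => h; [right; exact: lub_lower_covers h nyx nzx|left].
  by rewrite -dual_card; apply: (lub_lower_covers dP _ nyx nzx).
case=> h; last exact: lower_covers_reducible.
by rewrite -reducible_dual; apply: lower_covers_reducible => //; rewrite dual_card.
Qed.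

(** * Feet of elements and the order of a basic block *)

Section Foot.
Variables (T : finType) (le : rel T).

(* In a basic block an irreducible element has exactly one lower and one upper cover, so
   the defaults of [odflt] are not reached there. *)
Definition lower_foot x := if reducible le x then x else odflt x [pick p | covers le p x].
Definition upper_foot x := if reducible le x then x else odflt x [pick p | covers le x p].
End Foot.

Section Block.
Variables (T : finType) (le : rel T).
Hypothesis RC : is_RC_lattice le.
Hypothesis BB : basic_block le.
Hypothesis T1 : 1 < #|T|.

Notation red := (reducible le).
Notation lo := (lower_foot le).
Notation hi := (upper_foot le).

Let L : is_finite_lattice le := proj1 RC.
Let P : is_poset le := proj1 L.

Lemma red_total x y : red x -> red y -> le x y || le y x.
Proof. by case: RC => _; apply. Qed.

(** Of the three clauses of [basic_block], only the one on nullity is compatible with more than one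
    element and a doubly irreducible [x]. *)
Lemma irreducible_detour x : ~~ red x ->
  exists p q y, [/\ covers le p x, covers le x q, le p y, le y q &
                    [/\ y != p, y != q & y != x]].
Proof.
rewrite reducibleE // negbK => irr.
have [m mle] := bottom_exists L.
case: BB => [T1'|[none|drop]]; first by have := T1; rewrite T1'.
  by rewrite (negPf (none x)) in irr.
exact: nullity_drop_detour mle _ irr (drop x irr).
Qed.

Lemma lo_covers x : ~~ red x -> covers le (lo x) x.
Proof.
move=> nr; have [p [_ [_ [px _ _ _ _]]]] := irreducible_detour nr.
by rewrite /lower_foot (negPf nr); case: pickP => //= /(_ p); rewrite px.
Qed.

Lemma hi_covers x : ~~ red x -> covers le x (hi x).
Proof.
move=> nr; have [_ [p [_ [_ px _ _ _]]]] := irreducible_detour nr.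
by rewrite /upper_foot (negPf nr); case: pickP => //= /(_ p); rewrite px.
Qed.

Lemma lo_id x : red x -> lo x = x.
Proof. by rewrite /lower_foot => ->. Qed.

Lemma hi_id x : red x -> hi x = x.
Proof. by rewrite /upper_foot => ->. Qed.

Lemma lo_uniq x p : ~~ red x -> covers le p x -> lo x = p.
Proof.
move=> nr px; have := nr; rewrite reducibleE // negbK => /andP[_ /card_le1_eqP]; apply;
  by rewrite inE ?lo_covers.
Qed.

Lemma hi_uniq x p : ~~ red x -> covers le x p -> hi x = p.
Proof.
move=> nr px; have := nr; rewrite reducibleE // negbK => /andP[/card_le1_eqP + _]; apply;
  by rewrite inE ?hi_covers.
Qed.

Lemma le_lo x : le (lo x) x.
Proof.
case: (boolP (red x)) => [r|nr]; first by rewrite lo_id // (po_refl P).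
by have /covers_inP[] := lo_covers nr.
Qed.

Lemma le_hi x : le x (hi x).
Proof.
case: (boolP (red x)) => [r|nr]; first by rewrite hi_id // (po_refl P).
by have /covers_inP[] := hi_covers nr.
Qed.

Lemma lo_neq x : ~~ red x -> lo x != x.
Proof. by move/lo_covers/covers_inP=> []. Qed.

Lemma lo_max x y : ~~ red x -> le y x -> y != x -> le y (lo x).
Proof.
move=> nr yx nyx.
have [||z cz yz] := @lower_cover_in _ _ P setT y x _ _ yx nyx; rewrite ?inE //.
by rewrite (lo_uniq nr cz).
Qed.

Lemma hi_min x y : ~~ red x -> le x y -> y != x -> le (hi x) y.
Proof.
move=> nr xy; rewrite eq_sym => nxy.
have [||z cz yz] := @upper_cover_in _ _ setT x y P _ _ xy nxy; rewrite ?inE //.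
by rewrite (hi_uniq nr cz).
Qed.

(** The detour [y] meets [x] in the lower cover [p]: [x <= y] would force [q <= y], and all other
    common lower bounds are below [p]. *)
Lemma lo_red x : red (lo x).
Proof.
case: (boolP (red x)) => [r|nr]; first by rewrite lo_id.
have [p [q [y [px xq py yq [nyp nyq nyx]]]]] := irreducible_detour nr.
rewrite (lo_uniq nr px); have /covers_inP[_ _ lpx npx _] := px.
apply/reducibleP; exists x, y; rewrite eq_sym npx nyp; split=> //.
apply/orP; right; apply/is_glbP; split=> // z zx zy.
case: (eqVneq z x) => [e|nzx]; last by rewrite -(lo_uniq nr px) lo_max.
rewrite e in zy; have := hi_min nr zy nyx; rewrite (hi_uniq nr xq) => qy.
by rewrite (po_anti P yq qy) eqxx in nyq.
Qed.

Lemma hi_red x : red (hi x).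
Proof.
case: (boolP (red x)) => [r|nr]; first by rewrite hi_id.
have [p [q [y [px xq py yq [nyp nyq nyx]]]]] := irreducible_detour nr.
rewrite (hi_uniq nr xq); have /covers_inP[_ _ lxq nxq _] := xq.
apply/reducibleP; exists x, y; rewrite nxq nyq; split=> //.
apply/orP; left; apply/is_lubP; split=> // z xz yz.
case: (eqVneq z x) => [e|nzx]; last by rewrite -(hi_uniq nr xq) hi_min.
rewrite e in yz; have := lo_max nr yz nyx; rewrite (lo_uniq nr px) => yp.
by rewrite (po_anti P yp py) eqxx in nyp.
Qed.

Lemma le_hi_lo x y : le x y -> x != y -> le (hi x) (lo y).
Proof.
move=> xy nxy.
have hy : le (hi x) y.
  case: (boolP (red x)) => r; first by rewrite hi_id.
  by apply: hi_min; rewrite // eq_sym.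
case: (boolP (red y)) => r; first by rewrite lo_id.
by apply: lo_max => //; apply: contraNneq r => <-; apply: hi_red.
Qed.

(** Equality is listed separately because an irreducible [x] has [lo x] strictly below [hi x]. *)
Lemma leE x y : le x y = (x == y) || le (hi x) (lo y).
Proof.
apply/idP/orP => [xy|[/eqP->|h]]; last 2 first.
- exact: (po_refl P).
- exact: (po_trans P (po_trans P (le_hi x) h) (le_lo y)).
by case: (eqVneq x y) => [|nxy]; [left|right; apply: le_hi_lo].
Qed.

Lemma same_foot_incomparable x y :
  ~~ red x -> lo x = lo y -> hi x = hi y -> le x y -> x = y.
Proof.
move=> nr el eh xy; apply/eqP/negPn/negP => nxy.
have h := le_hi_lo xy nxy; rewrite -el in h.
case/eqP: (lo_neq nr); apply: (po_anti P); first exact: le_lo.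
exact: (po_trans P (le_hi x) h).
Qed.

Lemma between_incomparable x w : ~~ red x -> le (lo x) w -> w != lo x ->
  le w (hi x) -> w != hi x -> w != x -> ~~ le x w && ~~ le w x.
Proof.
move=> nr lw nlw wh nwh nwx; apply/andP; split; apply/negP => h.
  by case/eqP: nwh; apply: (po_anti P) => //; apply: hi_min.
by case/eqP: nlw; apply: (po_anti P) => //; apply: lo_max.
Qed.

(** The detour around [x] is irreducible, lying strictly between the feet of [x]. Its own feet are
    reducible and also lie in that interval, so they are the same. *)
Lemma foot_twin x : ~~ red x ->
  (forall w, red w -> le (lo x) w -> le w (hi x) -> w = lo x \/ w = hi x) ->
  exists y, [/\ ~~ red y, y != x, lo y = lo x & hi y = hi x].
Proof.
move=> nr consec; have [p [q [y [px xq py yq [nyp nyq nyx]]]]] := irreducible_detour nr.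
rewrite (lo_uniq nr px) (hi_uniq nr xq) in consec *.
have nry : ~~ red y.
  apply/negP => ry; case: (consec y ry py yq) => e; first by rewrite e eqxx in nyp.
  by rewrite e eqxx in nyq.
have pq : le p q by apply: (po_trans P py yq).
have npq : p != q.
  by apply: contraNneq nyp => e; apply/eqP/(po_anti P); rewrite // e.
have ply : le p (lo y) by apply: lo_max; rewrite // eq_sym.
have hyq : le (hi y) q by apply: hi_min; rewrite // eq_sym.
exists y; split=> //.
  case: (consec (lo y) (lo_red y) ply) => [||e] //.
    exact: (po_trans P (le_lo y) yq).
  case/eqP: nyq; apply: (po_anti P) => //; rewrite -e; exact: le_lo.
case: (consec (hi y) (hi_red y) _ hyq) => [|e|] //.
  exact: (po_trans P py (le_hi y)).
case/eqP: nyp; apply: (po_anti P) => //; rewrite -e; exact: le_hi.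
Qed.

(** Of two elements with join [u], the one with the higher upper foot has [u] as that foot, because
    it bounds both; meets are dual. This excludes isolated vertices. *)
Lemma red_foot u : red u -> exists2 z, ~~ red z & lo z = u \/ hi z = u.
Proof.
move=> ru; have /reducibleP[y [z [nyu nzu /orP[/is_lubP|/is_glbP] [yu zu ext]]]] := ru.
  wlog h : y z nyu nzu yu zu ext / le (hi y) (hi z).
    move=> W; have /orP[h|h] := red_total (hi_red y) (hi_red z); first exact: W h.
    by apply: W h => // w; move=> ? ?; apply: ext.
  have hu : le (hi z) u by have := le_hi_lo zu nzu; rewrite (lo_id ru).
  have e : hi z = u.
    apply: (po_anti P) => //; apply: ext; last exact: le_hi.
    exact: (po_trans P (le_hi y) h).
  exists z; last by right.
  by apply/negP => rz; rewrite hi_id // in e; rewrite e eqxx in nzu.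
wlog h : y z nyu nzu yu zu ext / le (lo z) (lo y).
  move=> W; have /orP[h|h] := red_total (lo_red y) (lo_red z); last exact: W h.
  by apply: W h => // w; move=> ? ?; apply: ext.
have hu : le u (lo z).
  by have := le_hi_lo zu; rewrite eq_sym nzu (hi_id ru); apply.
have e : lo z = u.
  apply: (po_anti P) => //; apply: ext; last exact: le_lo.
  exact: (po_trans P h (le_lo y)).
exists z; last by left.
by apply/negP => rz; rewrite lo_id // in e; rewrite e eqxx in nzu.
Qed.

Lemma le_rank x y : red x -> red y -> le x y = (red_rank le x <= red_rank le y).
Proof.
move=> rx ry; apply/idP/idP => [xy|].
  apply/subset_leq_card/subsetP => w; rewrite !inE => /and3P[-> wx nwx] /=.
  rewrite (po_trans P wx xy); apply: contraNneq nwx => e.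
  by rewrite e in wx *; apply/eqP/(po_anti P).
apply: contraLR => nxy; rewrite -ltnNge.
have yx : le y x by have := red_total rx ry; rewrite (negPf nxy).
have nyx : y != x by apply: contraNneq nxy => ->; apply: (po_refl P).
apply: proper_card; apply/properP; split.
  apply/subsetP => w; rewrite !inE => /and3P[-> wy nwy] /=.
  rewrite (po_trans P wy yx); apply: contraNneq nxy => <-; exact: wy.
by exists y; rewrite !inE ?ry ?yx ?nyx // eqxx !andbF.
Qed.

Lemma rank_inj x y : red x -> red y -> red_rank le x = red_rank le y -> x = y.
Proof.
by move=> rx ry e; apply: (po_anti P); rewrite le_rank // e.
Qed.

Lemma rank_lt x : red x -> red_rank le x < num_reducible le.
Proof.
move=> rx; apply: proper_card; apply/properP; split.
  by apply/subsetP => w; rewrite !inE => /and3P[].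
by exists x; rewrite !inE ?rx // eqxx !andbF.
Qed.

(** Distinct reducible elements have distinct ranks below their number, so by counting every such
    rank occurs. *)
Lemma rank_surj k : k < num_reducible le -> exists2 x, red x & red_rank le x = k.
Proof.
move En : (num_reducible le) => n; case: n En => // n En kn.
pose f x : 'I_n.+1 := inord (red_rank le x).
have fE x : red x -> val (f x) = red_rank le x.
  by move=> rx; rewrite /f /= inordK // -En rank_lt.
have inj : {in [set x | red x] &, injective f}.
  move=> x y; rewrite !inE => rx ry e; apply: rank_inj => //.
  by rewrite -!fE // e.
have /eqP im : f @: [set x | red x] == setT.
  by rewrite eqEcard subsetT cardsT card_ord (card_in_imset inj) -En /=.
have : Ordinal kn \in f @: [set x | red x] by rewrite im inE.
case/imsetP => x; rewrite inE => rx e; exists x => //.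
by rewrite -fE // -e.
Qed.

End Block.


(** * Adjunct pairs and feet *)

Section AdjunctRepresentation.
Variables (T : finType) (le : rel T).
Hypothesis RC : is_RC_lattice le.
Hypothesis BB : basic_block le.
Hypothesis T1 : 1 < #|T|.
Variables (r : nat) (c : T -> nat) (a b : nat -> T).
Hypothesis rep : adj_rep le r c a b.

Notation red := (reducible le).
Notation lo := (lower_foot le).
Notation hi := (upper_foot le).

Let L : is_finite_lattice le := proj1 RC.
Let P : is_poset le := proj1 L.
Let le_lo := le_lo RC BB T1.
Let le_hi := le_hi RC BB T1.
Let lo_red := lo_red RC BB T1.
Let hi_red := hi_red RC BB T1.
Let lo_max := lo_max RC BB T1.
Let hi_min := hi_min RC BB T1.

Lemma rep_chain x y : c x = c y -> le x y || le y x.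
Proof.
case: rep => cr [_ [ch0 [_ st]]] e; case: (posnP (c y)) => [c0|cpos].
  by apply: ch0; rewrite ?e.
by have [_ [h _]] := st (c y) (introT andP (conj cpos (cr y))); apply: h.
Qed.

Lemma rep_below x y : c x < c y -> le x y = le x (a (c y)).
Proof.
case: rep => cr [_ [_ [_ st]]] xy.
have [|_ [_ [_ [_ [_ [_ [_ [_ [h _]]]]]]]]] := st (c y); last exact: h.
by rewrite cr andbT; apply: leq_ltn_trans xy.
Qed.

Lemma rep_above x y : c y < c x -> le x y = le (b (c x)) y.
Proof.
case: rep => cr [_ [_ [_ st]]] xy.
have [|_ [_ [_ [_ [_ [_ [_ [_ [_ h]]]]]]]]] := st (c x); last exact: h.
by rewrite cr andbT; apply: leq_ltn_trans xy.
Qed.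

Lemma rep_pair k : 0 < k <= r ->
  [/\ c (a k) < k, c (b k) < k, exists w, c w = k &
      exists z, [/\ c z < k, z != a k, z != b k, le (a k) z & le z (b k)]].
Proof.
case: rep => cr [_ [_ [_ st]]] /st.
case=> ex [_ [_ [ak [bk [_ [_ [[z [zk [/eqP za [/eqP zb [az zb']]]]] _]]]]]]].
by split=> //; exists z; split.
Qed.

Lemma rep_index x : 0 < c x -> 0 < c x <= r.
Proof. by move=> ->; case: rep => cr _; apply: cr. Qed.

Lemma adjoined_between x : 0 < c x -> le (a (c x)) x /\ le x (b (c x)).
Proof.
move=> /rep_index /rep_pair[ax bx _ _].
by split; [rewrite rep_below|rewrite rep_above] => //; apply: (po_refl P).
Qed.

(* The chain adjoined at step k and the old elements between a_k and b_k meet in a_k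
   and join in b_k; later steps do not change this. *)
Lemma adjunct_pair_red k : 0 < k <= r -> red (a k) /\ red (b k).
Proof.
move=> kr; have [ak bk [w cw] [z [zk za zb az zb']]] := rep_pair kr.
have k0 : 0 < c w by rewrite cw; case/andP: kr.
have [aw wb] := adjoined_between k0; rewrite cw in aw wb.
have nwa : w != a k by apply: contraTneq ak => <-; rewrite cw ltnn.
have nwb : w != b k by apply: contraTneq bk => <-; rewrite cw ltnn.
split; apply/reducibleP; exists z, w; split=> //; apply/orP.
  right; apply/is_glbP; split=> // m.
  (* Induction on the chain of a lower bound [m]: if that chain comes after step [k], then [b (c m)]
     is an older lower bound above [m]. *)
  have [n] := ubnP (c m); elim: n m => // n IH m mn mz mw.
  case: (ltngtP (c m) k) => [mk|mk|mk].
  - by rewrite rep_below ?cw // in mw.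
  - have cm : 0 < c m by apply: leq_ltn_trans mk.
    have [_ mb] := adjoined_between cm; have [_ cb _ _] := rep_pair (rep_index cm).
    apply: (po_trans P mb); apply: IH.
    + exact: leq_trans cb _.
    + by rewrite -rep_above //; apply: ltn_trans mk.
    + by rewrite -rep_above // cw.
  rewrite rep_above mk // in mz.
  by case/eqP: zb; apply: (po_anti P).
left; apply/is_lubP; split=> // m.
have [n] := ubnP (c m); elim: n m => // n IH m mn zm wm.
case: (ltngtP (c m) k) => [mk|mk|mk].
- by rewrite rep_above ?cw // in wm.
- have cm : 0 < c m by apply: leq_ltn_trans mk.
  have [am _] := adjoined_between cm; have [ca _ _ _] := rep_pair (rep_index cm).
  apply: (po_trans P _ am); apply: IH.
  + exact: leq_trans ca _.
  + by rewrite -rep_below //; apply: ltn_trans mk.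
  + by rewrite -rep_below // cw.
rewrite rep_below mk // in zm.
by case/eqP: za; apply: (po_anti P).
Qed.

(** If [lo z] were newer than [z], then [lo z <= z] would pass through the reducible [b (c (lo z))],
    which is then below [lo z] as well and equals it, although it is older. The upper foot is
    dual. *)
Lemma foot_index z : ~~ red z -> c (lo z) <= c z /\ c (hi z) <= c z.
Proof.
move=> nr; split; rewrite leqNgt; apply/negP => lt.
  have pos : 0 < c (lo z) by apply: leq_ltn_trans lt.
  have [_ lb] := adjoined_between pos; have [_ cb _ _] := rep_pair (rep_index pos).
  have [_ rb] := adjunct_pair_red (rep_index pos).
  have bz := le_lo z; rewrite rep_above // in bz.
  have bl : le (b (c (lo z))) (lo z) by apply: lo_max => //; apply: contraNneq nr => <-.
  by rewrite -(po_anti P lb bl) ltnn in cb.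
have pos : 0 < c (hi z) by apply: leq_ltn_trans lt.
have [ah _] := adjoined_between pos; have [ca _ _ _] := rep_pair (rep_index pos).
have [ra _] := adjunct_pair_red (rep_index pos).
have za := le_hi z; rewrite rep_below // in za.
have ha : le (hi z) (a (c (hi z))) by apply: hi_min => //; apply: contraNneq nr => <-.
by rewrite (po_anti P ah ha) ltnn in ca.
Qed.

(** The reducible [a (c z)] is below [z], hence below [lo z]; conversely [lo z] is older than [z]
    and below it, hence below [a (c z)]. *)
Lemma new_pair_foot z : ~~ red z -> 0 < c z -> c (lo z) < c z -> c (hi z) < c z ->
  a (c z) = lo z /\ b (c z) = hi z.
Proof.
move=> nr pos cl ch; have [az zb] := adjoined_between pos.
have [ra rb] := adjunct_pair_red (rep_index pos).
split; apply: (po_anti P).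
- by apply: lo_max => //; apply: contraNneq nr => <-.
- by rewrite -rep_below.
- by rewrite -rep_above.
- by apply: hi_min => //; apply: contraNneq nr => <-.
Qed.

(* New and old elements of the interval are incomparable, so one of the two groups
   contains no reducible element. *)
Lemma pair_foot k : 0 < k <= r ->
  exists z, [/\ ~~ red z, lo z = a k & hi z = b k].
Proof.
move=> kr; have [ak bk [w cw] [z0 [zk za zb az zb']]] := rep_pair kr.
have k0 : 0 < k by case/andP: kr.
have [ra rb] := adjunct_pair_red kr.
case: (boolP [exists x, (c x == k) && red x]) => [/existsP[x /andP[/eqP cx rx]]|].
  (* A reducible [x] on the adjoined chain is incomparable with every older element strictly inside
     the interval, so none of these is reducible. The feet of [z0], being no newer than [z0], must
     be the endpoints. *)
  have old z : c z < k -> le (a k) z -> le z (b k) -> z != a k -> z != b k -> ~~ red z.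
    move=> cz laz lzb naz nzb; apply/negP => rz; have /orP[] := red_total RC rz rx.
      by rewrite rep_below cx // => h; case/eqP: naz; apply: (po_anti P).
    by rewrite rep_above cx // => h; case/eqP: nzb; apply: (po_anti P).
  have nr := old z0 zk az zb' za zb; have [cl ch] := foot_index nr.
  have al : le (a k) (lo z0) by apply: lo_max; rewrite // eq_sym.
  have hb : le (hi z0) (b k) by apply: hi_min; rewrite // eq_sym.
  exists z0; split=> //; apply/eqP/negPn/negP => h.
    suff : ~~ red (lo z0) by rewrite lo_red.
    apply: old => //; first exact: leq_ltn_trans zk.
      exact: (po_trans P (le_lo z0) zb').
    apply: contraNneq zb => e; apply/eqP/(po_anti P) => //; rewrite -e; exact: le_lo.
  suff : ~~ red (hi z0) by rewrite hi_red.
  apply: old => //; first exact: leq_ltn_trans zk.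
    exact: (po_trans P az (le_hi z0)).
  apply: contraNneq za => e; apply/eqP/(po_anti P) => //; rewrite -e; exact: le_hi.
(* Without reducible elements on the adjoined chain, the feet of [w] are strictly older than [w]. *)
move=> /existsPn none.
have nred x : red x -> c x != k by move=> rx; have := none x; rewrite rx andbT.
have nr : ~~ red w by apply/negP => /nred; rewrite cw eqxx.
have [cl ch] := foot_index nr; rewrite cw in cl ch.
have [|||ea eb] := @new_pair_foot w nr; rewrite ?cw //.
- by rewrite ltn_neqAle cl nred.
- by rewrite ltn_neqAle ch nred.
by exists w; rewrite cw in ea eb.
Qed.

(* Then z opens its chain on both sides, and that chain is adjoined at (lo z, hi z). *)
Definition grounded z := (c (lo z) < c z) && (c (hi z) < c z).

Lemma grounded_pair z : ~~ red z -> grounded z ->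
  [/\ 0 < c z <= r, a (c z) = lo z & b (c z) = hi z].
Proof.
move=> nr /andP[cl ch]; have pos : 0 < c z by apply: leq_ltn_trans cl.
by have [-> ->] := new_pair_foot nr pos cl ch; rewrite rep_index.
Qed.

Lemma same_foot_index x y :
  ~~ red x -> ~~ red y -> lo x = lo y -> hi x = hi y -> c x = c y -> x = y.
Proof.
move=> nx ny el eh /rep_chain/orP[] h.
  exact: (same_foot_incomparable RC BB T1 nx el eh h).
by symmetry; apply: (same_foot_incomparable RC BB T1 ny (esym el) (esym eh) h).
Qed.

(** The chain index of an ungrounded element is the larger of those of its feet, so common feet mean
    a common chain. *)
Lemma ungrounded_uniq x y : ~~ red x -> ~~ red y -> lo x = lo y -> hi x = hi y ->
  ~~ grounded x -> ~~ grounded y -> x = y.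
Proof.
move=> nx ny el eh gx gy; apply: same_foot_index => //.
have [clx chx] := foot_index nx; have [cly chy] := foot_index ny.
by rewrite /grounded el eh in clx chx gx *; rewrite /grounded in gy; lia.
Qed.

(** Take a reducible [w] strictly between the feet with least chain index. It is newer than [z], and
    its adjunct pair is the feet of [z]: otherwise an endpoint of the pair would be an older choice
    for [w]. *)
Lemma ungrounded_pair z w0 : ~~ red z -> ~~ grounded z ->
  red w0 -> le (lo z) w0 -> le w0 (hi z) -> w0 != lo z -> w0 != hi z ->
  exists w, [/\ 0 < c w <= r, a (c w) = lo z, b (c w) = hi z, red w &
                [/\ le (lo z) w, le w (hi z), w != lo z & w != hi z]].
Proof.
move=> nr ng rw0 lw0 w0h nlw0 nhw0.
pose B w := [&& red w, le (lo z) w, le w (hi z), w != lo z & w != hi z].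
have Bw0 : B w0 by apply/and5P.
case: (@arg_minnP _ w0 B c Bw0) => w /and5P[rw lw wh nlw nhw] wmin.
have nwz : w != z by apply: contraNneq nr => <-.
have /andP[nzw nwz'] := between_incomparable RC BB T1 nr lw nlw wh nhw nwz.
have [cl ch] := foot_index nr.
(* [w] and [z] are incomparable, so their chains differ. If [w] were older, the foot of [z] on the
   chain of [z] would make them comparable through the adjunct pair of that chain. *)
have ckz : c z < c w.
  rewrite ltnNge; apply/negP; rewrite leq_eqVlt => /orP[/eqP/rep_chain|lt].
    by rewrite (negPf nzw) (negPf nwz').
  have pos : 0 < c z by apply: leq_ltn_trans lt.
  have [az zb] := adjoined_between pos.
  have /orP[/eqP e|/eqP e] : (c (lo z) == c z) || (c (hi z) == c z).
  - by move: ng; rewrite !eqn_leq cl ch negb_and -!leqNgt.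
  - by rewrite rep_above e // in lw; rewrite (po_trans P zb lw) in nzw.
  - by rewrite rep_below e // in wh; rewrite (po_trans P wh az) in nwz'.
have pos : 0 < c w by apply: leq_ltn_trans ckz.
have [aw wb] := adjoined_between pos.
have [ra rb] := adjunct_pair_red (rep_index pos).
have [ca cb _ _] := rep_pair (rep_index pos).
have la : le (lo z) (a (c w)) by rewrite -rep_below //; apply: leq_ltn_trans ckz.
have bh : le (b (c w)) (hi z) by rewrite -rep_above //; apply: leq_ltn_trans ckz.
exists w; split=> //; first exact: rep_index.
  apply/eqP/negPn/negP => ne; suff /wmin : B (a (c w)) by rewrite leqNgt ca.
  apply/and5P; split=> //; first exact: (po_trans P aw wh).
  apply: contraNneq nhw => e; apply/eqP/(po_anti P) => //; rewrite -e; exact: aw.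
apply/eqP/negPn/negP => ne; suff /wmin : B (b (c w)) by rewrite leqNgt cb.
apply/and5P; split=> //; first exact: (po_trans P lw wb).
apply: contraNneq nlw => e; apply/eqP/(po_anti P) => //; rewrite -e; exact: wb.
Qed.

(** A grounded [z] supplies the pair by its own chain. Otherwise a reducible element between the
    feet does, or, if there is none, the twin of [z], which is grounded since only one element with
    these feet is not. *)
Lemma foot_pair z : ~~ red z ->
  exists i, [/\ 0 < i <= r, a i = lo z & b i = hi z].
Proof.
move=> nr; case: (boolP (grounded z)) => [g|ng]; first by exists (c z); apply: grounded_pair.
case: (boolP [exists w, [&& red w, le (lo z) w, le w (hi z), w != lo z & w != hi z]]).
  case/existsP=> w /and5P[rw lw wh nlw nhw].
  have [w' [h1 h2 h3 _ _]] := ungrounded_pair nr ng rw lw wh nlw nhw.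
  by exists (c w').
move=> /existsPn none.
have [|y [ny nyz el eh]] := foot_twin RC BB T1 nr.
  move=> w rw lw wh; have := none w; rewrite rw lw wh /= negb_and !negbK.
  by case/orP=> /eqP; [left|right].
have gy : grounded y.
  apply: contraNT nyz => ngy; apply/eqP; exact: ungrounded_uniq.
by exists (c y); rewrite -el -eh; apply: grounded_pair.
Qed.

Section Distinct.
Hypothesis distinct : forall i j,
  1 <= i <= r -> 1 <= j <= r -> a i = a j -> b i = b j -> i = j.

Lemma grounded_uniq x y : ~~ red x -> ~~ red y -> lo x = lo y -> hi x = hi y ->
  grounded x -> grounded y -> x = y.
Proof.
move=> nx ny el eh gx gy; apply: same_foot_index => //.
have [ix ax bx] := grounded_pair nx gx; have [iy ay by_] := grounded_pair ny gy.
by apply: distinct; rewrite // ?ax ?ay ?bx ?by_.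
Qed.

(** For given feet there is at most one grounded element, as the pairs are distinct, and at most one
    ungrounded one. *)
Lemma foot_fiber_le2 x y z : ~~ red x -> ~~ red y -> ~~ red z ->
  lo x = lo y -> hi x = hi y -> lo x = lo z -> hi x = hi z ->
  [|| x == y, x == z | y == z].
Proof.
move=> nx ny nz el eh el' eh'.
have el'' : lo y = lo z by rewrite -el.
have eh'' : hi y = hi z by rewrite -eh.
case: (boolP (grounded x)) => gx; case: (boolP (grounded y)) => gy;
case: (boolP (grounded z)) => gz;
first [ by rewrite (grounded_uniq nx ny el eh) ?eqxx
      | by rewrite (grounded_uniq nx nz el' eh') ?eqxx ?orbT
      | by rewrite (grounded_uniq ny nz el'' eh'') ?eqxx ?orbT
      | by rewrite (ungrounded_uniq nx ny el eh) ?eqxx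
      | by rewrite (ungrounded_uniq nx nz el' eh') ?eqxx ?orbT
      | by rewrite (ungrounded_uniq ny nz el'' eh'') ?eqxx ?orbT ].
Qed.

(** An ungrounded [x] now yields a reducible [v] whose chain is adjoined at the common feet. A
    grounded [y] would, by distinctness of the pairs, share the chain of [v], yet the two are
    incomparable. *)
Lemma foot_fiber_le1 x y w : ~~ red x -> ~~ red y ->
  lo x = lo y -> hi x = hi y ->
  red w -> le (lo x) w -> le w (hi x) -> w != lo x -> w != hi x -> x = y.
Proof.
wlog gxy : x y / ~~ grounded x || grounded y.
  move=> W nx ny el eh rw lw wh nlw nhw.
  case: (boolP (~~ grounded x || grounded y)) => [|ng]; first by move=> g; apply: W.
  symmetry; apply: W; rewrite -?el -?eh //.
  by move: ng; rewrite negb_or negbK => /andP[->]; rewrite orbT.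
move=> nx ny el eh rw lw wh nlw nhw; case: (boolP (grounded x)) gxy => gx /= gy.
  exact: grounded_uniq.
case: (boolP (grounded y)) => {}gy; last exact: ungrounded_uniq.
have [v [iv av bv rv [lv vh nlv nhv]]] := ungrounded_pair nx gx rw lw wh nlw nhw.
have [iy ay by_] := grounded_pair ny gy.
have /rep_chain : c v = c y by apply: distinct; rewrite // ?av ?bv ?ay ?by_.
rewrite el eh in lv vh nlv nhv.
have nvy : v != y by apply: contraNneq ny => <-.
have /andP[nyv nvy'] := between_incomparable RC BB T1 ny lv nlv vh nhv nvy.
by rewrite (negPf nyv) (negPf nvy').
Qed.

End Distinct.
End AdjunctRepresentation.


(** * Bijections from equal fiber sizes *)

Lemma fiber_inj (T1 T2 : finType) (K : eqType) (f1 : T1 -> K) (f2 : T2 -> K) (y0 : T2) :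
  (forall k, #|[set x | f1 x == k]| = #|[set y | f2 y == k]|) ->
  exists2 g : T1 -> T2, injective g & forall x, f2 (g x) = f1 x.
Proof.
move=> H; pose A k := enum [set x | f1 x == k]; pose B k := enum [set y | f2 y == k].
have sz k : size (A k) = size (B k) by rewrite -!cardE.
have Ax x : x \in A (f1 x) by rewrite mem_enum inE.
(* Matching fibers are paired by position in their enumerations; equal sizes keep the default [y0]
   out of reach. *)
pose g x := nth y0 (B (f1 x)) (index x (A (f1 x))).
have ix x : index x (A (f1 x)) < size (B (f1 x)) by rewrite -sz index_mem.
have gf x : f2 (g x) = f1 x.
  by have := mem_nth y0 (ix x); rewrite mem_enum inE => /eqP.
exists g => // x y e; have ef : f1 x = f1 y by rewrite -!gf e.
have /eqP := e; rewrite /g ef nth_uniq ?enum_uniq // -?ef // => /eqP ei.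
by rewrite -(nth_index x (Ax x)) ei ef nth_index.
Qed.

Lemma fiber_bij (T1 T2 : finType) (K : eqType) (f1 : T1 -> K) (f2 : T2 -> K)
    (x0 : T1) (y0 : T2) :
  (forall k, #|[set x | f1 x == k]| = #|[set y | f2 y == k]|) ->
  exists2 g : T1 -> T2, bijective g & forall x, f2 (g x) = f1 x.
Proof.
move=> H; have [g gi gf] := fiber_inj y0 H.
have [h hi _] := fiber_inj x0 (fun k => esym (H k)).
by exists g => //; apply: inj_card_bij => //; apply: leq_card hi.
Qed.

(** * The digraph determines the block *)

Section FundamentalBlock.
Variables (T : finType) (le : rel T).
Hypothesis F : fundamental_basic_block le.
Hypothesis n2 : 2 <= num_reducible le.

Notation red := (reducible le).
Notation lo := (lower_foot le).
Notation hi := (upper_foot le).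
Notation rk := (red_rank le).

Let RC : is_RC_lattice le := proj1 F.
Let BB : basic_block le := proj1 (proj2 F).
Let T1 : 1 < #|T| := leq_trans n2 (max_card _).
Let lo_red := lo_red RC BB T1.
Let hi_red := hi_red RC BB T1.
Let P : is_poset le := proj1 (proj1 RC).

Definition foot_rank x := (rk (lo x), rk (hi x)).

(** This frees arcs from the choice of representation: [pair_foot] applies to any of them,
    [foot_pair] to the one that comes with the block. *)
Lemma GF_arcP n (i j : 'I_n) :
  GF_arc le i j <-> exists2 z, ~~ red z & foot_rank z = (i : nat, j : nat).
Proof.
split=> [|[z nz [ri rj]]].
  case=> x [y [/and4P[_ _ /eqP ri /eqP rj] [r [c [a [b [rep [k [kr [ak bk]]]]]]]]]].
  have [z [nz lz hz]] := pair_foot RC BB T1 rep kr.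
  by exists z => //; rewrite /foot_rank lz hz ak bk ri rj.
exists (lo z), (hi z); rewrite lo_red hi_red ri rj !eqxx; split=> //.
case: F => _ [_ [r [c [a [b [rep _]]]]]].
have [k [kr ak bk]] := foot_pair RC BB T1 rep nz.
by exists r, c, a, b; split=> //; exists k.
Qed.

Lemma foot_rank_le x : rk (lo x) <= rk (hi x) ?= iff red x.
Proof.
have lh : le (lo x) (hi x) := po_trans P (le_lo RC BB T1 x) (le_hi RC BB T1 x).
split; first by rewrite -le_rank.
apply/idP/idP => [/eqP e|rx]; last by rewrite lo_id // hi_id.
apply: contraT => nx; have e' := rank_inj RC (lo_red x) (hi_red x) e.
case/eqP: (lo_neq RC BB T1 nx); apply: (po_anti P); first exact: le_lo.
by rewrite e'; apply: le_hi.
Qed.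

Lemma foot_rank_eq x y : foot_rank x = foot_rank y -> lo x = lo y /\ hi x = hi y.
Proof. by case=> e1 e2; split; apply: (rank_inj RC). Qed.

(** Diagonal keys belong to reducible elements. The fiber of an arc has two elements when the ranks
    are consecutive, by [foot_twin] and [foot_fiber_le2]; otherwise the reducible element of rank
    [i.+1] lies strictly between and leaves one. *)
Lemma card_foot_fiber i j :
  #|[set x | foot_rank x == (i, j)]| =
  if i == j then (i < num_reducible le) : nat
  else if [exists z, ~~ red z && (foot_rank z == (i, j))] then (j == i.+1).+1 else 0.
Proof.
case: eqVneq => [<-|nij].
  case: ltnP => [/(rank_surj RC)[x rx rkx]|ni].
    rewrite [RHS]/= -(cards1 x); apply: eq_card => y; rewrite !inE.
    apply/eqP/eqP => [[e1 e2]|->]; last by rewrite /foot_rank lo_id // hi_id // rkx.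
    have ry : red y by rewrite -(foot_rank_le y) e1 e2.
    by rewrite lo_id // in e1; apply: (rank_inj RC); rewrite // e1.
  apply/eqP; rewrite cards_eq0; apply/eqP/setP => y; rewrite !inE; apply/eqP => -[e1 _].
  by have := rank_lt (lo_red y); rewrite e1 ltnNge ni.
have nred z : foot_rank z = (i, j) -> ~~ red z.
  by case=> e1 e2; rewrite -(foot_rank_le z) e1 e2.
case: ifP => [/existsP[z /andP[nz /eqP fz]]|/existsPn none]; last first.
  apply/eqP; rewrite cards_eq0; apply/eqP/setP => y; rewrite !inE; apply/eqP => fy.
  by have := none y; rewrite fy eqxx (nred _ fy).
case: F => _ [_ [r [c [a [b [rep dist]]]]]].
have [fz1 fz2] := fz.
have ij : i < j by rewrite ltn_neqAle nij -fz1 -fz2 foot_rank_le.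
case: eqVneq => [ej|nj].
  have [|y [ny nyz el eh]] := foot_twin RC BB T1 nz.
    move=> w rw lw wh; rewrite !le_rank // fz1 fz2 ej in lw wh.
    rewrite leq_eqVlt ltnS in wh; case/orP: wh => [/eqP wh|wh]; [right|left].
      by apply: (rank_inj RC); rewrite // wh fz2.
    by apply: (rank_inj RC); rewrite // fz1; apply/eqP; rewrite eqn_leq wh.
  have -> : [set x | foot_rank x == (i, j)] = [set y; z].
    apply/setP => x; rewrite !inE; apply/eqP/orP => [fx|]; last first.
      by case=> /eqP-> //; rewrite /foot_rank el eh.
    have [lx hx] : lo z = lo x /\ hi z = hi x by apply: foot_rank_eq; rewrite fz fx.
    have := foot_fiber_le2 RC BB T1 rep dist nz (nred _ fx) ny lx hx (esym el) (esym eh).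
    by rewrite (eq_sym z y) (negPf nyz) (eq_sym z x) => /orP[|/=]; [right|left].
  by rewrite cards2 nyz.
have [|w rw rkw] := @rank_surj _ _ RC i.+1.
  by apply: leq_ltn_trans (rank_lt (hi_red z)); rewrite fz2.
rewrite [RHS]/= -(cards1 z); apply: eq_card => x; rewrite !inE.
apply/eqP/eqP => [fx|->] //.
have [lx hx] : lo z = lo x /\ hi z = hi x by apply: foot_rank_eq; rewrite fz fx.
symmetry; apply: (foot_fiber_le1 RC BB T1 rep dist nz (nred _ fx) lx hx rw).
- by rewrite le_rank // rkw fz1.
- by rewrite le_rank // rkw fz2.
- by apply/eqP => e; move/eqP: rkw; rewrite e fz1 eqn_leq ltnn andbF.
- by apply/eqP => e; rewrite e fz2 in rkw; rewrite rkw eqxx in nj.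
Qed.

Lemma le_foot_rank x y : le x y = (x == y) || ((foot_rank x).2 <= (foot_rank y).1).
Proof. by rewrite (leE RC BB T1) -le_rank. Qed.

Lemma lo_rank_lt x : (foot_rank x).1 < num_reducible le.
Proof. exact: rank_lt. Qed.

Lemma hi_rank_lt x : (foot_rank x).2 < num_reducible le.
Proof. exact: rank_lt. Qed.

(** The number of arcs is kept as [#|D|]; that it is the nullity follows later by comparison with
    the constructed block. *)
Lemma arc_set_exists n : num_reducible le = n ->
  exists D : {set 'I_n * 'I_n}, Dgraph #|D| D /\
    forall i j : 'I_n, (i, j) \in D <-> GF_arc le i j.
Proof.
move=> En.
pose D := [set p : 'I_n * 'I_n | 
             [exists z, ~~ red z && (foot_rank z == (p.1 : nat, p.2 : nat))]].
exists D; split; last first.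
  move=> i j; rewrite inE; apply: (iff_trans _ (iff_sym (GF_arcP i j))).
  split=> [/existsP[z /andP[nz /eqP e]]|[z nz e]]; first by exists z.
  by apply/existsP; exists z; rewrite nz e eqxx.
apply/and3P; split=> //.
  apply/forallP => p; apply/implyP; rewrite inE => /existsP[z /andP[nz /eqP[e1 e2]]].
  by rewrite ltn_neqAle -e1 -e2 !(foot_rank_le z) andbT.
apply/forallP => v.
have [|u ru rku] := @rank_surj _ _ RC v; first by rewrite En.
have [z nz hz] := red_foot RC BB T1 ru.
have l1 : rk (lo z) < n by rewrite -En; apply: lo_rank_lt.
have l2 : rk (hi z) < n by rewrite -En; apply: hi_rank_lt.
apply/existsP; exists (Ordinal l1, Ordinal l2); rewrite inE; apply/andP; split.
  by apply/existsP; exists z; rewrite nz /= eqxx.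
by case: hz => <- in rku *; rewrite -!val_eqE /= rku eqxx ?orbT.
Qed.

End FundamentalBlock.

(** Equal arcs give equal fibers of [foot_rank], hence a bijection preserving it, and by
    [le_foot_rank] this key together with equality determines the order. *)
Lemma fundamental_block_iso n (T1 T2 : finType) (le1 : rel T1) (le2 : rel T2) :
  2 <= n -> fundamental_basic_block le1 -> fundamental_basic_block le2 ->
  num_reducible le1 = n -> num_reducible le2 = n ->
  (forall i j : 'I_n, GF_arc le1 i j <-> GF_arc le2 i j) -> poset_iso le1 le2.
Proof.
move=> n2 F1 F2 e1 e2 arcs.
have n21 : 2 <= num_reducible le1 by rewrite e1.
have n22 : 2 <= num_reducible le2 by rewrite e2.
have /card_gt0P[x0 _] : 0 < #|T1| by apply: leq_trans (leq_trans n21 (max_card _)).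
have /card_gt0P[y0 _] : 0 < #|T2| by apply: leq_trans (leq_trans n22 (max_card _)).
have [|g gb gf] := @fiber_bij _ _ _ (foot_rank le1) (foot_rank le2) x0 y0.
  case=> i j; rewrite !card_foot_fiber // e1 e2; case: eqVneq => // _.
  congr (if _ then _ else _); apply/existsP/existsP => -[z /andP[nz /eqP fz]].
    have li : i < n by have := lo_rank_lt F1 n21 z; rewrite fz e1.
    have lj : j < n by have := hi_rank_lt F1 n21 z; rewrite fz e1.
    have : GF_arc le1 (Ordinal li) (Ordinal lj) by apply/GF_arcP => //; exists z.
    by move/arcs/GF_arcP => [//|//|y ny fy]; exists y; rewrite ny fy eqxx.
  have li : i < n by have := lo_rank_lt F2 n22 z; rewrite fz e2.
  have lj : j < n by have := hi_rank_lt F2 n22 z; rewrite fz e2.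
  have : GF_arc le2 (Ordinal li) (Ordinal lj) by apply/GF_arcP => //; exists z.
  by move/arcs/GF_arcP => [//|//|y ny fy]; exists y; rewrite ny fy eqxx.
exists g; split=> // x y; rewrite (le_foot_rank F1 n21) (le_foot_rank F2 n22) !gf.
by rewrite (bij_eq gb).
Qed.

(** * Invariance under isomorphism *)

Section Iso.
Variables (T1 T2 : finType) (le1 : rel T1) (le2 : rel T2) (f : T1 -> T2).
Hypothesis fb : bijective f.
Hypothesis fle : forall x y, le1 x y = le2 (f x) (f y).

Lemma covers_iso x y : covers le1 x y = covers le2 (f x) (f y).
Proof.
have [g fK gK] := fb.
apply/covers_inP/covers_inP; rewrite !inE (bij_eq fb) fle => -[_ _ xy nxy h]; split=> // z _.
  rewrite -[z]gK -!fle => xz zy; case: (h (g z)); rewrite ?inE // => ->; by [left|right].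
by rewrite !fle => xz zy; case: (h (f z)); rewrite ?inE // => /(bij_inj fb) ->; [left|right].
Qed.

Lemma is_lub_iso x y j : is_lub le1 x y j = is_lub le2 (f x) (f y) (f j).
Proof.
have [g fK gK] := fb.
apply/is_lubP/is_lubP; rewrite !fle => -[h1 h2 h]; split=> // z.
  by rewrite -[z]gK -!fle; apply: h.
by rewrite !fle; apply: h.
Qed.

Lemma is_glb_iso x y j : is_glb le1 x y j = is_glb le2 (f x) (f y) (f j).
Proof.
have [g fK gK] := fb.
apply/is_glbP/is_glbP; rewrite !fle => -[h1 h2 h]; split=> // z.
  by rewrite -[z]gK -!fle; apply: h.
by rewrite !fle; apply: h.
Qed.

Lemma reducible_iso x : reducible le1 x = reducible le2 (f x).
Proof.
have [g fK gK] := fb.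
apply/reducibleP/reducibleP => -[y [z [h1 h2 h3]]].
  by exists (f y), (f z); rewrite !(bij_eq fb) -is_lub_iso -is_glb_iso.
by exists (g y), (g z); rewrite is_lub_iso is_glb_iso !gK -!(bij_eq fb) !gK.
Qed.

Lemma red_rank_iso x : red_rank le1 x = red_rank le2 (f x).
Proof.
rewrite /red_rank -(on_card_preimset (f := f)); last exact: onW_bij.
by apply: eq_card => y; rewrite !inE reducible_iso fle (bij_eq fb).
Qed.

(** Both cover graphs are connected because of the bottoms, so only elements and coverings are
    compared. *)
Lemma nullity_iso : is_finite_lattice le1 -> is_finite_lattice le2 ->
  nullity le1 setT = nullity le2 setT.
Proof.
move=> L1 L2; have [m1 h1] := bottom_exists L1; have [m2 h2] := bottom_exists L2.
rewrite (nullity_bottom (proj1 L1) h1) (nullity_bottom (proj1 L2) h2).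
rewrite (bij_eq_card fb); congr (_.+1 - _).
pose ff (p : T1 * T1) := (f p.1, f p.2).
have ffb : bijective ff.
  have [g fK gK] := fb.
  by exists (fun p => (g p.1, g p.2)) => -[u v]; rewrite /ff /= ?fK ?gK.
rewrite -(on_card_preimset (f := ff)); last exact: onW_bij.
by apply: eq_card => y; rewrite !inE covers_iso.
Qed.

Lemma GF_arc_iso n (i j : 'I_n) :
  fundamental_basic_block le1 -> fundamental_basic_block le2 ->
  2 <= num_reducible le1 -> 2 <= num_reducible le2 ->
  GF_arc le1 i j -> GF_arc le2 i j.
Proof.
move=> F1 F2 n1 n2 /(GF_arcP F1 n1)[z nz fz]; apply/(GF_arcP F2 n2).
have nfz : ~~ reducible le2 (f z) by rewrite -reducible_iso.
exists (f z) => //; rewrite -fz /foot_rank !red_rank_iso; congr pair; congr red_rank.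
  apply: lo_uniq nfz _; rewrite -?covers_iso; try by case: F2 => ? [].
    exact: leq_trans n2 (max_card _).
  case: F1 => ? [? _]; apply: lo_covers => //; exact: leq_trans n1 (max_card _).
apply: hi_uniq nfz _; rewrite -?covers_iso; try by case: F2 => ? [].
  exact: leq_trans n2 (max_card _).
case: F1 => ? [? _]; apply: hi_covers => //; exact: leq_trans n1 (max_card _).
Qed.

End Iso.


(** * Construction of a block from a digraph *)

Section Model.
Variables (n : nat) (D : {set 'I_n * 'I_n}).

(* [inl k] is the k-th reducible element and [inr (p, b)] a doubly irreducible element
   between the reducible elements p.1 and p.2. An arc between consecutive vertices needs
   two such elements, since a single one would be the only path from p.1 to p.2. *)
Definition valid_code (x : 'I_n + ('I_n * 'I_n) * bool) : bool :=
  match x with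
  | inl _ => true
  | inr (p, b) => (p \in D) && (b ==> (p.2 == p.1.+1 :> nat))
  end.

Notation digraph_block := {x | valid_code x}.

(** [blo] and [bhi] are the intended ranks of the feet; [ble] copies the description of the order in
    [leE]. *)
Definition blo (x : digraph_block) : nat :=
  match val x with inl k => k | inr (p, _) => p.1 end.
Definition bhi (x : digraph_block) : nat :=
  match val x with inl k => k | inr (p, _) => p.2 end.
Definition ble (x y : digraph_block) : bool := (x == y) || (bhi x <= blo y).
Definition is_vert (x : digraph_block) : bool := if val x is inl _ then true else false.
Definition vert (k : 'I_n) : digraph_block := exist valid_code (inl k) isT.

Hypothesis n2 : 2 <= n.
Hypothesis D_lt : forall p, p \in D -> p.1 < p.2.
Hypothesis D_cover : forall v, exists2 p, p \in D & p.1 = v \/ p.2 = v.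

Let k0 : 'I_n := Ordinal (ltnW n2).

(** The default vertex is returned only for an invalid code. *)
Definition arc p b : digraph_block := insubd (vert k0) (inr (p, b)).

Lemma arcK p b : p \in D -> b ==> (p.2 == p.1.+1 :> nat) -> val (arc p b) = inr (p, b).
Proof. by move=> pD h; rewrite val_insubd /= pD h. Qed.

Lemma arcFK p : p \in D -> val (arc p false) = inr (p, false).
Proof. by move=> pD; rewrite arcK. Qed.

Variant block_spec (x : digraph_block) : Prop :=
| BlockVert k of x = vert k
| BlockArc p b of p \in D & b ==> (p.2 == p.1.+1 :> nat) & x = arc p b.

Lemma blockP x : block_spec x.
Proof.
case: x => -[k|[p b]] v.
  by apply: (@BlockVert _ k); apply: val_inj.
by have /andP[pD h] := v; apply: (@BlockArc _ p b) => //; apply: val_inj; rewrite arcK.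
Qed.

Lemma blo_vert k : blo (vert k) = k. Proof. by []. Qed.
Lemma bhi_vert k : bhi (vert k) = k. Proof. by []. Qed.

Lemma blo_arc p b : p \in D -> b ==> (p.2 == p.1.+1 :> nat) -> blo (arc p b) = p.1.
Proof. by move=> pD h; rewrite /blo arcK. Qed.

Lemma bhi_arc p b : p \in D -> b ==> (p.2 == p.1.+1 :> nat) -> bhi (arc p b) = p.2.
Proof. by move=> pD h; rewrite /bhi arcK. Qed.

Lemma vert_inj : injective vert.
Proof. by move=> i j /(congr1 val) []. Qed.

Lemma arc_inj p b q d : p \in D -> b ==> (p.2 == p.1.+1 :> nat) ->
  q \in D -> d ==> (q.2 == q.1.+1 :> nat) -> arc p b = arc q d -> p = q /\ b = d.
Proof. by move=> pD h qD h' /(congr1 val); rewrite !arcK // => -[]. Qed.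

Lemma arc_vert p b k : p \in D -> b ==> (p.2 == p.1.+1 :> nat) -> arc p b != vert k.
Proof. by move=> pD h; rewrite -val_eqE arcK. Qed.

Lemma blo_le x : blo x <= bhi x ?= iff is_vert x.
Proof.
case: (blockP x) => [k ->|p b pD h ->]; first by split; rewrite /blo /bhi //= eqxx.
have := D_lt pD; rewrite blo_arc // bhi_arc // /is_vert arcK // => lt.
by split; rewrite ?(ltnW lt) // ltn_eqF.
Qed.

Lemma ble_vert x k : ble x (vert k) = (bhi x <= k).
Proof.
by rewrite /ble blo_vert; case: eqVneq => // ->; rewrite bhi_vert leqnn.
Qed.

Lemma vert_ble x k : ble (vert k) x = (k <= blo x).
Proof.
by rewrite /ble bhi_vert; case: eqVneq => // <-; rewrite blo_vert leqnn.
Qed.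

Lemma ble_neq x y : x != y -> ble x y = (bhi x <= blo y).
Proof. by rewrite /ble => /negPf->. Qed.

Lemma ble_neqr x y : y != x -> ble x y = (bhi x <= blo y).
Proof. by rewrite eq_sym; apply: ble_neq. Qed.

Lemma block_poset : is_poset ble.
Proof.
split; [|split] => [x|x y|y x z]; first by rewrite /ble eqxx.
- case: (eqVneq x y) => // nxy; rewrite ble_neq // ble_neqr // => /andP[h1 h2].
  (* The cycle of inequalities collapses, so both elements are vertices with the same number. *)
  have := blo_le x; have := blo_le y => -[h3 h4] [h5 h6].
  have vx : is_vert x by rewrite -h6; lia.
  have vy : is_vert y by rewrite -h4; lia.
  have exy : blo x = blo y by lia.
  case: (blockP x) vx exy => [i ->|p b pD h ->]; last by rewrite /is_vert arcK.
  case: (blockP y) vy => [j ->|p b pD h ->]; last by rewrite /is_vert arcK.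
  by move=> _ _ /val_inj->.
rewrite /ble => /orP[/eqP->|h1] // /orP[/eqP<-|h2]; first by rewrite h1 orbT.
by rewrite (leq_trans h1 (leq_trans (blo_le y) h2)) orbT.
Qed.

Let P := block_poset.

Lemma bhi_lt x : bhi x < n.
Proof. by rewrite /bhi; case: (val x) => [k|[p b]]. Qed.

Lemma blo_lt x : blo x < n.
Proof. exact: leq_ltn_trans (blo_le x) (bhi_lt x). Qed.

(** Incomparable elements join in the vertex at the larger [bhi] and meet in the vertex at the
    smaller [blo]. [S] is general because [adj_rep] asks for a lattice at every stage. *)
Lemma block_lattice_on (S : {pred digraph_block}) :
  (forall k, vert k \in S) -> is_lattice_on ble S.
Proof.
move=> vS x y xS yS; case: (boolP (ble x y)) => xy.
  split.
    exists y; rewrite /is_lub_in yS xy (po_refl P) /=; apply/forallP => z.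
    by apply/implyP => _; apply/implyP => _; apply/implyP.
  exists x; rewrite /is_glb_in xS xy (po_refl P) /=; apply/forallP => z.
  by apply/implyP => _; apply/implyP => h; apply/implyP.
case: (boolP (ble y x)) => yx.
  split.
    exists x; rewrite /is_lub_in xS yx (po_refl P) /=; apply/forallP => z.
    by apply/implyP => _; apply/implyP => h; apply/implyP.
  exists y; rewrite /is_glb_in yS yx (po_refl P) /=; apply/forallP => z.
  by apply/implyP => _; apply/implyP => _; apply/implyP.
have lt1 : maxn (bhi x) (bhi y) < n by rewrite gtn_max !bhi_lt.
have lt2 : minn (blo x) (blo y) < n by rewrite gtn_min !blo_lt.
split.
  exists (vert (Ordinal lt1)); rewrite /is_lub_in vS !ble_vert /= leq_maxl leq_maxr /=.
  apply/forallP => z; apply/implyP => _; apply/implyP => xz; apply/implyP => yz.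
  have nxz : x != z by apply: contraNneq yx => ->.
  have nyz : y != z by apply: contraNneq xy => ->.
  by rewrite vert_ble /= geq_max -!ble_neq // xz.
exists (vert (Ordinal lt2)); rewrite /is_glb_in vS !vert_ble /= geq_minl geq_minr /=.
apply/forallP => z; apply/implyP => _; apply/implyP => zx; apply/implyP => zy.
have nzx : z != x by apply: contraNneq xy => <-.
have nzy : z != y by apply: contraNneq yx => <-.
by rewrite ble_vert /= leq_min -!ble_neq // zx.
Qed.

Lemma block_lattice : is_finite_lattice ble.
Proof.
split; first exact: block_poset; split; last exact: block_lattice_on.
by apply/card_gt0P; exists (vert k0).
Qed.

(** A detour around [arc p false]: the second copy if the ends are consecutive, else the vertex
    after [p.1]. For [p] in [D] the default [p.2] is not reached. *)
Definition mate (p : 'I_n * 'I_n) : digraph_block :=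
  if p.2 == p.1.+1 :> nat then arc p true else vert (insubd p.2 p.1.+1).

Lemma mateP p : p \in D ->
  [/\ p.1 <= blo (mate p), bhi (mate p) <= p.2,
      mate p != vert p.1, mate p != vert p.2 &
      [/\ mate p != arc p false, ~~ ble (arc p false) (mate p) &
          ~~ ble (mate p) (arc p false)]].
Proof.
move=> pD; have lt := D_lt pD.
have ne : mate p != arc p false.
  rewrite /mate; case: ifP => e; last by rewrite eq_sym arc_vert.
  by apply/eqP => /arc_inj[] //; rewrite e.
rewrite (ble_neqr ne) (ble_neq ne) blo_arc // bhi_arc //; move: ne.
rewrite /mate; case: ifP => e ne.
  rewrite blo_arc ?bhi_arc ?e // leqnn !arc_vert ?e //.
  by rewrite -ltnNge (eqP e) ltnS leqnn.
have lt' : p.1.+1 < p.2 by rewrite ltn_neqAle eq_sym e.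
have vk : (insubd p.2 p.1.+1 : 'I_n) = p.1.+1 :> nat.
  by rewrite val_insubd (ltn_trans lt').
rewrite ne blo_vert bhi_vert vk !(inj_eq vert_inj) -!val_eqE /= vk.
by rewrite gtn_eqF ?ltn_eqF // leqnSn (ltnW lt') -ltnNge lt' ltnn.
Qed.

(** [arc p false] and [mate p] have meet [vert p.1] and join [vert p.2], and every vertex is an end
    of some arc. *)
Lemma vert_reducible k : reducible ble (vert k).
Proof.
have [p pD pk] := D_cover k; have [h1 h2 h3 h4 [h5 h6 h7]] := mateP pD.
case: pk => <-; apply/reducibleP; exists (arc p false), (mate p);
  rewrite arc_vert //; split=> //; apply/orP; [right; apply/is_glbP|left; apply/is_lubP].
  rewrite !vert_ble blo_arc // leqnn; split=> // m mz mw.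
  have nm : m != arc p false by apply: contraNneq h6 => <-.
  by rewrite ble_vert; rewrite ble_neq // blo_arc // in mz.
rewrite !ble_vert bhi_arc // leqnn; split=> // m zm wm.
have nm : arc p false != m by apply: contraNneq h7 => ->.
by rewrite vert_ble; rewrite ble_neq // bhi_arc // in zm.
Qed.

(** Everything strictly below the arc is below [vert p.1], and so are joins of such elements; meets
    are dual. *)
Lemma arc_irreducible p b : p \in D -> b ==> (p.2 == p.1.+1 :> nat) ->
  ~~ reducible ble (arc p b).
Proof.
move=> pD h; have lt := D_lt pD.
apply/negP => /reducibleP[y [z [ny nz /orP[/is_lubP|/is_glbP] [hy hz ext]]]].
  rewrite !ble_neq // blo_arc // in hy hz.
  by have := ext (vert p.1); rewrite !ble_vert bhi_arc // => /(_ hy hz); rewrite leqNgt lt.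
rewrite !ble_neqr // bhi_arc // in hy hz.
by have := ext (vert p.2); rewrite !vert_ble blo_arc // => /(_ hy hz); rewrite leqNgt lt.
Qed.

Lemma block_reducible x : reducible ble x = is_vert x.
Proof.
case: (blockP x) => [k ->|p b pD h ->]; first by rewrite vert_reducible.
by rewrite (negPf (arc_irreducible pD h)) /is_vert arcK.
Qed.

Lemma block_RC : is_RC_lattice ble.
Proof.
split=> [|x y]; first exact: block_lattice.
rewrite !block_reducible.
case: (blockP x) => [i ->|p b pD h ->]; last by rewrite /is_vert arcK.
case: (blockP y) => [j ->|p b pD h ->]; last by rewrite /is_vert arcK.
by rewrite !ble_vert !bhi_vert leq_total.
Qed.

Lemma block_num_reducible : num_reducible ble = n.
Proof.
rewrite /num_reducible -[RHS](card_ord n) -cardsT -(card_imset _ vert_inj).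
apply: eq_card => x; rewrite inE block_reducible; apply/idP/imsetP => [|[k _ ->]] //.
by case: (blockP x) => [i ->|p b pD h ->]; [exists i|rewrite /is_vert arcK].
Qed.

Lemma block_rank k : red_rank ble (vert k) = k.
Proof.
have -> : red_rank ble (vert k) = #|[set j : 'I_n | j < k]|.
  rewrite -(card_imset _ vert_inj); apply: eq_card => x.
  rewrite !inE block_reducible; apply/and3P/imsetP.
    case: (blockP x) => [i ->|p b pD h ->]; last by rewrite /is_vert arcK // => -[].
    rewrite ble_vert bhi_vert (inj_eq vert_inj) => -[_ ik nik].
    by exists i; rewrite // inE ltn_neqAle ik andbT.
  case=> j; rewrite inE => jk ->; rewrite ble_vert bhi_vert (inj_eq vert_inj).
  by rewrite -val_eqE /= (ltn_eqF jk) ltnW.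
rewrite -sum1_card (eq_bigl (fun j : 'I_n => j < k)) => [|j]; last by rewrite inE.
by rewrite -(big_ord_widen n (fun=> 1) (ltnW (ltn_ord k))) sum_nat_const card_ord muln1.
Qed.

Lemma covers_vert_arc p b : p \in D -> b ==> (p.2 == p.1.+1 :> nat) ->
  covers ble (vert p.1) (arc p b).
Proof.
move=> pD h; apply/covers_inP; rewrite !inE vert_ble blo_arc // eq_sym arc_vert //.
split=> // z _ lz zh; case: (eqVneq z (arc p b)) => nz; [by right|left].
rewrite ble_neq // blo_arc // in zh; rewrite vert_ble in lz.
by apply: (po_anti P); rewrite ?ble_vert ?vert_ble.
Qed.

Lemma covers_arc_vert p b : p \in D -> b ==> (p.2 == p.1.+1 :> nat) ->
  covers ble (arc p b) (vert p.2).
Proof.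
move=> pD h; apply/covers_inP; rewrite !inE ble_vert bhi_arc // arc_vert //.
split=> // z _ lz zh; case: (eqVneq z (arc p b)) => nz; [by left|right].
rewrite ble_neqr // bhi_arc // in lz; rewrite ble_vert in zh.
by apply: (po_anti P); rewrite ?ble_vert ?vert_ble.
Qed.

Definition ord_below (k : 'I_n) : 'I_n := Ordinal (leq_ltn_trans (leq_pred k) (ltn_ord k)).

(* A spanning tree of the cover graph, rooted at the bottom element. *)
Definition parent (x : digraph_block) : digraph_block :=
  match val x with
  | inl k => if (ord_below k, k) \in D then arc (ord_below k, k) true
             else vert (ord_below k)
  | inr (p, _) => vert p.1
  end.

Lemma parent_covers x : x != vert k0 -> covers ble (parent x) x.
Proof.
case: (blockP x) => [k ->|p b pD h ->]; last first.
  by move=> _; rewrite /parent arcK //; apply: covers_vert_arc.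
rewrite (inj_eq vert_inj) -val_eqE /= => nk0.
have kS : k = (ord_below k).+1 :> nat by rewrite /= prednK // lt0n.
rewrite /parent /=; case: ifP => kD.
  by apply: (@covers_arc_vert (ord_below k, k) true) => //=; apply/eqP.
have lk : ord_below k < k by rewrite [X in _ < X]kS.
apply/covers_inP; rewrite !inE ble_vert bhi_vert (inj_eq vert_inj) -val_eqE.
rewrite (ltnW lk) neq_ltn lk; split=> // z _.
rewrite ble_vert vert_ble; case: (blockP z) => [j ->|p b pD h ->].
  rewrite blo_vert bhi_vert => h1 h2.
  case: (ltngtP j k) => h3; last by right; congr vert; apply: val_inj.
    left; congr vert; apply: val_inj; apply/eqP; rewrite eqn_leq h1 andbT.
    by rewrite -ltnS -kS.
  by rewrite leqNgt h3 in h2.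
rewrite blo_arc // bhi_arc // => h1 h2; have h3 := D_lt pD.
(* An arc between these consecutive vertices could only be [(ord_below k, k)], which is not in [D]
   here. *)
case/negP: kD; suff -> : (ord_below k, k) = p by [].
have e2 : k = p.2 by apply: val_inj; apply/eqP; rewrite /= eqn_leq h2 kS (leq_ltn_trans h1).
have e1 : ord_below k = p.1.
  apply: val_inj; apply/eqP; rewrite eqn_leq h1 -ltnS -kS.
  exact: leq_trans h3 h2.
by rewrite e1 e2; case: (p).
Qed.

(** An arc covers only its lower end, its parent. A vertex covers the preceding vertex or arcs
    ending in it; each of these is its parent unless it is a first copy [arc p false]. *)
Lemma covers_parent x y : covers ble x y ->
  (y != vert k0 /\ x = parent y) \/ (exists2 p, p \in D & x = arc p false /\ y = vert p.2).
Proof.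
case/covers_inP=> _ _ xy nxy btw.
have xy' := xy; rewrite ble_neq // in xy'.
case: (blockP y) xy xy' nxy btw => [k ->|p b pD h ->] xy xy' nxy btw; last first.
  left; split; first exact: arc_vert.
  rewrite /parent arcK // ; rewrite blo_arc // in xy'.
  case: (btw (vert p.1)); rewrite ?inE ?ble_vert ?vert_ble ?blo_arc // => e.
  by have := arc_vert p.1 pD h; rewrite e eqxx.
rewrite blo_vert in xy'.
have nk0 : vert k != vert k0.
  apply: contraNneq nxy => ek; apply/eqP/(po_anti P) => //.
  by rewrite ek vert_ble.
case: (blockP x) xy xy' nxy btw => [j ->|p b pD h ->] xy xy' nxy btw.
  left; split=> //; rewrite bhi_vert in xy'.
  have jk : j < k by rewrite ltn_neqAle xy' andbT; rewrite (inj_eq vert_inj) in nxy.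
  have jn : j.+1 < n by apply: leq_ltn_trans jk _.
  have ek : j.+1 = k :> nat.
    case: (btw (vert (Ordinal jn))); rewrite ?inE ?ble_vert ?vert_ble ?blo_vert //=.
      by move/vert_inj/(congr1 val) => /= /eqP; rewrite eqn_leq ltnn.
    by move/vert_inj/(congr1 val).
  have ej : ord_below k = j by apply: val_inj; rewrite /= -ek.
  rewrite /parent /= ej; case: ifP => // jD.
  case: (btw (arc (j, k) false)); rewrite ?inE ?ble_vert ?vert_ble ?blo_arc ?bhi_arc //= => e.
    by have := @arc_vert (j, k) false j jD isT; rewrite e eqxx.
  by have := @arc_vert (j, k) false k jD isT; rewrite e eqxx.
have ek : vert p.2 = vert k.
  rewrite bhi_arc // in xy'.
  case: (btw (vert p.2)); rewrite ?inE ?ble_vert ?bhi_arc // => e.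
  by have := arc_vert p.2 pD h; rewrite e eqxx.
case: b h {xy xy' nxy btw} => h; last by right; exists p; rewrite // ek.
left; split=> //; have kp := vert_inj ek; rewrite -kp /parent /=.
have -> : ord_below p.2 = p.1 by apply: val_inj; rewrite /= (eqP h).
by rewrite -surjective_pairing pD.
Qed.

(** The tree has one edge for each element other than the bottom; the remaining edges are indexed by
    [D]. *)
Lemma block_card_covers :
  #|[set p | covers ble p.1 p.2]| = #|{: digraph_block}|.-1 + #|D|.
Proof.
pose A := [set (parent y, y) | y in [set~ vert k0]].
pose B := [set (arc p false, vert p.2) | p in D].
have -> : [set p | covers ble p.1 p.2] = A :|: B.
  apply/setP => -[x y]; rewrite !inE /=; apply/idP/orP.
    case/covers_parent => [[ny ->]|[p pD [-> ->]]]; [left|right]; apply/imsetP.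
      by exists y; rewrite ?inE.
    by exists p.
  case=> /imsetP[z]; first by rewrite !inE => nz [-> ->]; apply: parent_covers.
  by move=> zD [-> ->]; apply: covers_arc_vert.
rewrite cardsU.
(* A parent is a vertex or a second copy [arc _ true], never a first copy. *)
have -> : A :&: B = set0.
  apply/setP => p; rewrite !inE; apply/negP => /andP[/imsetP[y _ ->] /imsetP[q qD [e ey]]].
  move: e; rewrite ey /parent /=; case: ifP => d.
    by move/(congr1 val); rewrite arcFK // val_insubd; case: ifP.
  by move=> e; have := @arc_vert q false (ord_below q.2) qD isT; rewrite e eqxx.
rewrite cards0 subn0 card_imset; last by move=> x y [].
rewrite card_in_imset; last by move=> p q pD qD [/arc_inj[]].
by rewrite cardsC1.
Qed.

Lemma D_gt0 : 0 < #|D|.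
Proof. by have [p pD _] := D_cover k0; apply/card_gt0P; exists p. Qed.

Lemma block_bottom x : ble (vert k0) x.
Proof. by rewrite vert_ble. Qed.

Lemma block_card_gt0 : 0 < #|{: digraph_block}|.
Proof. by apply/card_gt0P; exists (vert k0). Qed.

Lemma block_nullity : nullity ble setT = #|D|.
Proof.
rewrite (nullity_bottom P block_bottom) block_card_covers -addSn.
by rewrite (prednK block_card_gt0) addKn.
Qed.

Lemma block_basic : basic_block ble.
Proof.
right; right=> x irr.
have : ~~ reducible ble x by rewrite (reducibleE _ block_lattice) negbK.
case: (blockP x) irr => [k ->|p b pD h ->] irr; first by rewrite vert_reducible.
move=> _.
(* The bound required by [nullity_delete] holds because [D] is nonempty. *)
have ET : #|{: digraph_block}| <= #|[set p | covers ble p.1 p.2]|.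
  by rewrite block_card_covers -{1}(prednK block_card_gt0) -addn1 leq_add2l D_gt0.
have px := covers_vert_arc pD h; have xq := covers_arc_vert pD h.
have [h1 h2 h3 h4 [h5 h6 h7]] := mateP pD.
(* The detour around the second copy is the first; around the first copy it is [mate p]. *)
case: b h irr px xq => h irr px xq.
  apply: (@nullity_delete _ _ P _ _ _ _ (arc p false) block_bottom irr px xq _ _ _ _ _ ET).
  - by rewrite vert_ble blo_arc.
  - by rewrite ble_vert bhi_arc.
  - exact: arc_vert.
  - exact: arc_vert.
  - by apply/eqP => /arc_inj[].
by apply: (@nullity_delete _ _ P _ _ _ _ (mate p) block_bottom irr px xq _ _ _ _ _ ET);
  rewrite ?vert_ble ?ble_vert.
Qed.

(** Chain [0] holds the vertices and second copies. Each first copy forms its own chain, numbered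
    from [1] along [enum D]; [adj_lo] and [adj_hi] undo the shift by [i.-1]. *)
Definition chain_index (x : digraph_block) : nat :=
  if val x is inr (p, false) then (index p (enum D)).+1 else 0.
Definition adj_lo i := vert (nth (k0, k0) (enum D) i.-1).1.
Definition adj_hi i := vert (nth (k0, k0) (enum D) i.-1).2.

Lemma chain_index0_comparable x y :
  chain_index x = 0 -> chain_index y = 0 -> ble x y || ble y x.
Proof.
rewrite /chain_index.
case: (blockP x) => [i ->|p [] pD h ->]; rewrite ?arcK //= => _.
  rewrite vert_ble ble_vert.
  case: (blockP y) => [j ->|q [] qD h ->]; rewrite ?arcK //= => _.
    by rewrite blo_vert bhi_vert leq_total.
  by rewrite blo_arc // bhi_arc //; move/eqP: h => ->; case: leqP.
case: (blockP y) => [i ->|q [] qD h' ->]; rewrite ?arcK //= => _.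
  by rewrite vert_ble ble_vert blo_arc // bhi_arc //; move/eqP: h => ->; case: ltnP.
case: (eqVneq p q) => [->|npq]; first by rewrite (po_refl P).
have n1 : arc p true != arc q true.
  by apply: contraNneq npq => /arc_inj[] // ->.
rewrite (ble_neq n1) (ble_neqr n1) !blo_arc // !bhi_arc //.
have npq1 : p.1 != q.1 :> nat.
  apply: contraNneq npq => e1; rewrite [p]surjective_pairing [q]surjective_pairing.
  apply/eqP; congr pair; apply: val_inj => //.
  by move/eqP: h => /= ->; move/eqP: h' => /= ->; rewrite e1.
by move/eqP: h => /= ->; move/eqP: h' => /= ->; rewrite -neq_ltn.
Qed.

(** The mate on chain [0] witnesses both that this chain is maximal and that the ends of an adjunct
    pair do not form a covering. *)
Lemma mate_index p : p \in D -> chain_index (mate p) = 0.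
Proof.
by move=> pD; rewrite /mate; case: ifP => // h; rewrite /chain_index arcK ?h.
Qed.

Lemma block_adj_rep : adj_rep ble #|D| chain_index adj_lo adj_hi.
Proof.
split; [|split; [|split; [|split]]].
- move=> x; rewrite /chain_index; case: (blockP x) => [k ->|p [] pD h ->];
    rewrite ?arcK //=.
  by rewrite cardE index_mem mem_enum.
- by exists (vert k0).
- exact: chain_index0_comparable.
- move=> y; case: (blockP y) => [k ->|p [] pD h ->] //; rewrite /chain_index ?arcK //=.
  have [_ _ _ _ [_ h6 h7]] := mateP pD.
  by move/(_ _ (mate_index pD)); rewrite (negPf h6) (negPf h7).
move=> i; rewrite /adj_lo /adj_hi; case: i => // i /= lti.
set p := nth _ _ _.
have si : i < size (enum D) by rewrite -cardE.
have pD : p \in D by rewrite -mem_enum mem_nth.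
have ip : index p (enum D) = i by rewrite index_uniq ?enum_uniq.
have idx x : chain_index x = i.+1 -> x = arc p false.
  rewrite /chain_index; case: (blockP x) => [k ->|q [] qD h ->] //; rewrite arcK //=.
  by case=> e; rewrite /p -e nth_index // mem_enum.
have cp : chain_index (arc p false) = i.+1 by rewrite /chain_index arcFK //= ip.
have lt := D_lt pD.
split; first by exists (arc p false).
split; first by move=> x y /idx-> /idx->; rewrite (po_refl P).
split; first exact: block_lattice_on.
split=> //; split=> //; split; first by rewrite ble_vert ltnW.
split; first by move/vert_inj => e; rewrite e ltnn in lt.
split.
  have [h1 h2 /eqP h3 /eqP h4 _] := mateP pD.
  by exists (mate p); rewrite mate_index // vert_ble ble_vert.
split=> x y.
  move=> cx /idx->; rewrite ble_vert ble_neq ?blo_arc //.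
  by apply: contraTneq cx => ->; rewrite cp ltnn.
move=> /idx-> cy; rewrite vert_ble ble_neq ?bhi_arc //.
by apply: contraTneq cy => <-; rewrite cp ltnn.
Qed.

Lemma block_fundamental : fundamental_basic_block ble.
Proof.
split; first exact: block_RC; split; first exact: block_basic.
exists #|D|, chain_index, adj_lo, adj_hi; split; first exact: block_adj_rep.
move=> [|i] [|j] //= li lj /vert_inj /= e1 /vert_inj /= e2; congr _.+1; apply/eqP.
rewrite -(@nth_uniq _ (k0, k0) (enum D)) ?enum_uniq -?cardE //.
by apply/eqP; rewrite [LHS]surjective_pairing [RHS]surjective_pairing e1 e2.
Qed.

Lemma block_arcs (i j : 'I_n) : (i, j) \in D <-> GF_arc ble i j.
Proof.
have F := block_fundamental; have m2 : 2 <= num_reducible ble by rewrite block_num_reducible.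
have B1 : 1 < #|{: digraph_block}| := leq_trans m2 (max_card _).
have foot p b : p \in D -> b ==> (p.2 == p.1.+1 :> nat) ->
    foot_rank ble (arc p b) = (p.1 : nat, p.2 : nat).
  move=> pD h; have nr := arc_irreducible pD h; rewrite /foot_rank.
  rewrite (lo_uniq block_RC block_basic B1 nr (covers_vert_arc pD h)).
  by rewrite (hi_uniq block_RC block_basic B1 nr (covers_arc_vert pD h)) !block_rank.
apply: iff_trans (iff_sym (GF_arcP F m2 i j)); split=> [ijD|[z]].
  by exists (arc (i, j) false); [apply: arc_irreducible|rewrite foot].
case: (blockP z) => [k ->|p b pD h ->]; first by rewrite vert_reducible.
rewrite foot // => _ [/val_inj e1 /val_inj e2].
by rewrite -e1 -e2 -surjective_pairing.
Qed.

End Model.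

(** * The correspondence with digraphs *)

Lemma DgraphP n l (D : {set 'I_n * 'I_n}) : Dgraph l D ->
  [/\ forall p, p \in D -> p.1 < p.2, #|D| = l &
      forall v, exists2 p, p \in D & p.1 = v \/ p.2 = v].
Proof.
case/and3P=> /forallP lt /eqP card /forallP cov; split=> // [p pD|v].
  by have := lt p; rewrite pD.
have /existsP[p /andP[pD /orP[]/eqP e]] := cov v; exists p => //; [by left|by right].
Qed.

Theorem mainTheorem14 (n l : nat) :
  2 <= n -> (n.+1)./2 <= l <= 'C(n, 2) ->
  (* the map is well defined on isomorphism classes *)
  (forall (T1 T2 : finType) (le1 : rel T1) (le2 : rel T2),
     in_Fnl n l le1 -> in_Fnl n l le2 -> poset_iso le1 le2 ->
     forall i j : 'I_n, GF_arc le1 i j <-> GF_arc le2 i j) /\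
  (* it lands in D(n,l) *)
  (forall (T : finType) (le : rel T), in_Fnl n l le ->
     exists D : {set 'I_n * 'I_n}, Dgraph l D /\
       forall i j : 'I_n, (i, j) \in D <-> GF_arc le i j) /\
  (* injective on isomorphism classes *)
  (forall (T1 T2 : finType) (le1 : rel T1) (le2 : rel T2),
     in_Fnl n l le1 -> in_Fnl n l le2 ->
     (forall i j : 'I_n, GF_arc le1 i j <-> GF_arc le2 i j) ->
     poset_iso le1 le2) /\
  (* surjective onto D(n,l) *)
  (forall D : {set 'I_n * 'I_n}, Dgraph l D ->
     exists (T : finType) (le : rel T), in_Fnl n l le /\
       forall i j : 'I_n, (i, j) \in D <-> GF_arc le i j).
Proof.
move=> n2 _; split; [|split; [|split]].
- move=> T1 T2 le1 le2 [F1 [e1 _]] [F2 [e2 _]] [f [fb fle]] i j.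
  have [g fK gK] := fb.
  have gle x y : le2 x y = le1 (g x) (g y) by rewrite fle !gK.
  have gb : bijective g by exists f.
  by split; [apply: (GF_arc_iso fb fle)|apply: (GF_arc_iso gb gle)]; rewrite ?e1 ?e2.
- move=> T le [F [e nul]].
  have n2' : 2 <= num_reducible le by rewrite e.
  have [D [DD arcs]] := arc_set_exists F n2' e; exists D; split=> //.
  (* The block built from [D] has the same arcs, so it is isomorphic to the given one, and its
     nullity [#|D|] is [l]. *)
  have [lt _ cov] := DgraphP DD.
  have FB := block_fundamental n2 lt cov.
  have [|f [fb fle]] := fundamental_block_iso n2 F FB e (block_num_reducible n2 lt cov).
    by move=> i j; apply: iff_trans (iff_sym (arcs i j)) (block_arcs n2 lt cov i j).
  suff <- : #|D| = l by [].
  rewrite -nul (nullity_iso fb fle (proj1 (proj1 F)) (proj1 (proj1 FB))).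
  by rewrite (block_nullity n2 lt).
- move=> T1 T2 le1 le2 [F1 [e1 _]] [F2 [e2 _]].
  exact: fundamental_block_iso.
move=> D /DgraphP[lt card cov]; exists {x | valid_code D x}, (@ble n D).
split; last exact: block_arcs n2 lt cov.
split; first exact: block_fundamental.
by rewrite (block_num_reducible n2 lt cov) (block_nullity n2 lt).
Qed.
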